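(* Thompson's group $\mathrm{F}$ and the group $G_0$ lie in the class (LEJI). That is, if $\Gamma$ is either of the groups $\mathrm{F}$ or $G_0$, then for every finitely generated subgroup $H\leq \Gamma$ and every surjective homomorphism $\phi:H\to J$ onto a just infinite group $J$, the group $J$ is virtually abelian.
   Context: A group is just infinite if every nontrivial normal subgroup is of finite index. A group is elementarily just infinite if every just infinite quotient of it is virtually abelian (i.e. has an abelian subgroup of finite index). A group is locally elementarily just infinite, or in the class (LEJI), if every finitely generated subgroup of it is elementarily just infinite. $\mathrm{PL}^+[0,1]$ is the group, under composition, of piecewise linear orientation preserving homeomorphisms of $[0,1]$ (with finitely many breakpoints). Thompson's group $\mathrm{F}\leq \mathrm{PL}^+[0,1]$ is the subgroup of elements whose slopes, whenever they exist, lie in $\{2^n\mid n\in\mathbf{Z}\}$ and whose breakpoints lie in $\mathbf{Z}[\frac12]\cap[0,1]$. $G_0$ is the Lodha–Moore group: the finitely presented nonamenable group without free subgroups of rank 2 which is the group of homeomorphisms of $\mathbf{R}$ generated (under composition) by the three maps $a,b,c$ given by $a(t)=t+1$; $b(t)=t$ if $t\leq 0$, $b(t)=\frac{t}{1-t}$ if $0\leq t\leq \frac12$, $b(t)=3-\frac1t$ if $\frac12\leq t\leq 1$, $b(t)=t+1$ if $t\geq 1$; and $c(t)=\frac{2t}{1+t}$ if $0\leq t\leq 1$, $c(t)=t$ otherwise. *)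

(* Defs.v *)
From HB Require Import structures.
From mathcomp Require Import all_boot all_order all_algebra.
From mathcomp Require Import all_classical all_reals all_analysis.
From mathcomp Require Import ring lra.

Set Implicit Arguments.
Unset Strict Implicit.
Unset Printing Implicit Defensive.

Import Order.TTheory GRing.Theory Num.Theory.
Import numFieldNormedType.Exports.

(* Subgroups of a [groupType] are the library's [groupClosed] predicates;
   since logic is classical, every subset is of the form [{pred G}]. *)

Section GroupNotions.
Local Open Scope group_scope.

Definition subgroup_type (G : groupType) (H : groupClosed G) : Type :=
  {x : G | x \in H}.

HB.instance Definition _ (G : groupType) (H : groupClosed G) :=
  SubChoice.on (subgroup_type H).

Lemma subgroup_closed (G : groupType) (H : groupClosed G) :
  group_closed (fun x => x \in H).
Proof. by split=> [|x y xH yH]; [exact: gpred1 | exact: gpredF]. Qed.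

HB.instance Definition _ (G : groupType) (H : groupClosed G) :=
  SubChoice_isSubGroup.Build G (fun x => x \in H) (subgroup_type H)
    (@subgroup_closed G H).

Definition in_generated (G : groupType) (S : {pred G}) (x : G) : Prop :=
  forall K : groupClosed G, {subset S <= K} -> x \in K.

Definition generated (G : groupType) (S : {pred G}) : {pred G} :=
  fun x => `[< in_generated S x >].

Section Generated.
Variables (G : groupType) (S : {pred G}).

Lemma generated_mul : mulg_closed (generated S).
Proof.
move=> x y /asboolP xS /asboolP yS; apply/asboolP => K SK.
by apply: gpredM; [exact: xS | exact: yS].
Qed.

Lemma generated1 : 1 \in generated S.
Proof. by apply/asboolP => K _; exact: gpred1. Qed.

Lemma generated_inv : invg_closed (generated S).
Proof. by move=> x /asboolP xS; apply/asboolP => K /xS; rewrite gpredV. Qed.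

HB.instance Definition _ := isMulClosed.Build G (generated S) generated_mul.
HB.instance Definition _ := isMul1Closed.Build G (generated S) generated1.
HB.instance Definition _ := isInvClosed.Build G (generated S) generated_inv.

End Generated.

Definition finitely_generated (G : groupType) : Prop :=
  exists s : seq G, forall x : G, x \in generated (mem s).

(* Finitely many left cosets cover the group. *)
Definition finite_index (G : groupType) (N : groupClosed G) : Prop :=
  exists s : seq G, forall x : G, exists2 t, t \in s & t^-1 * x \in N.

Definition normal_subgroup (G : groupType) (N : groupClosed G) : Prop :=
  forall x y : G, x \in N -> x ^ y \in N.

Definition just_infinite (G : groupType) : Prop :=
  forall N : groupClosed G, normal_subgroup N ->
    (exists2 x, x \in N & x != 1) -> finite_index N.

Definition virtually_abelian (G : groupType) : Prop :=
  exists2 A : groupClosed G, finite_index A & {in A &, forall x y, commute x y}.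

(* Quotients are taken up to isomorphism, as surjective morphisms onto [J]. *)
Definition elementarily_just_infinite (G : groupType) : Prop :=
  forall (J : groupType) (phi : {multiplicative G -> J}),
    (forall y : J, exists x : G, phi x = y) ->
    just_infinite J -> virtually_abelian J.

Definition LEJI (G : groupType) : Prop :=
  forall H : groupClosed G, finitely_generated (subgroup_type H) ->
    elementarily_just_infinite (subgroup_type H).

End GroupNotions.

(* The inverse is determined by the function: [homeoP] below. *)
Record homeo (T : topologicalType) := Homeo {
  homeo_fun :> T -> T;
  homeo_inv : T -> T;
  homeo_funK : cancel homeo_fun homeo_inv;
  homeo_invK : cancel homeo_inv homeo_fun;
  homeo_fun_cts : continuous homeo_fun;
  homeo_inv_cts : continuous homeo_inv }.

Section HomeoGroup.
Variable T : topologicalType.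
Implicit Types f g h : homeo T.

Lemma homeoP f g : f =1 g -> f = g.
Proof.
case: f g => [f f' fK Kf cf cf'] [g g' gK Kg cg cg'] /= /funext efg.
subst g.
have efg' : f' = g' by apply/funext => x; rewrite -[x in LHS]Kg fK.
subst g'.
by congr Homeo; exact: Prop_irrelevance.
Qed.

HB.instance Definition _ := gen_eqMixin (homeo T).
HB.instance Definition _ := gen_choiceMixin (homeo T).

Lemma homeo_id_cts : continuous (@id T).
Proof. by move=> x; exact: cvg_id. Qed.

Definition homeo_one : homeo T :=
  Homeo (fun=> erefl) (fun=> erefl) homeo_id_cts homeo_id_cts.

Lemma homeo_comp_cts (u v : T -> T) :
  continuous u -> continuous v -> continuous (u \o v).
Proof. by move=> cu cv x; apply: continuous_comp; [exact: cv | exact: cu]. Qed.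

Definition homeo_mul f g : homeo T :=
  @Homeo T (f \o g) (homeo_inv g \o homeo_inv f)
    (can_comp (@homeo_funK _ f) (@homeo_funK _ g))
    (can_comp (@homeo_invK _ g) (@homeo_invK _ f))
    (homeo_comp_cts (@homeo_fun_cts _ f) (@homeo_fun_cts _ g))
    (homeo_comp_cts (@homeo_inv_cts _ g) (@homeo_inv_cts _ f)).

Definition homeo_inverse f : homeo T :=
  Homeo (@homeo_invK _ f) (@homeo_funK _ f)
    (@homeo_inv_cts _ f) (@homeo_fun_cts _ f).

Lemma homeo_mulA : associative homeo_mul.
Proof. by move=> f g h; exact: homeoP. Qed.

Lemma homeo_mul1 : left_id homeo_one homeo_mul.
Proof. by move=> f; exact: homeoP. Qed.

Lemma homeo_1mul : right_id homeo_one homeo_mul.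
Proof. by move=> f; exact: homeoP. Qed.

Lemma homeo_mulV : left_inverse homeo_one homeo_inverse homeo_mul.
Proof. by move=> f; apply: homeoP => x /=; rewrite homeo_funK. Qed.

Lemma homeo_Vmul : right_inverse homeo_one homeo_inverse homeo_mul.
Proof. by move=> f; apply: homeoP => x /=; rewrite homeo_invK. Qed.

HB.instance Definition _ := isGroup.Build (homeo T)
  homeo_mulA homeo_mul1 homeo_1mul homeo_mulV homeo_Vmul.

End HomeoGroup.

Section IncreasingHomeo.
Local Open Scope ring_scope.
Variables (R : realType) (f g : R -> R).
Hypotheses (f_incr : {homo f : x y / x < y}) (fK : cancel f g) (gK : cancel g f).

Lemma increasing_inv : {homo g : x y / x < y}.
Proof.
move=> x y xy; rewrite ltNge; apply/negP; rewrite le_eqVlt => /orP[/eqP e|].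
  by move: xy; rewrite -(gK x) -(gK y) e ltxx.
by move/f_incr; rewrite !gK => /(lt_trans xy); rewrite ltxx.
Qed.

Lemma increasing_continuous : continuous f.
Proof.
move=> x; apply/cvgrPdist_lt => e e0.
have xI : x \in `](g (f x - e)), (g (f x + e))[.
  by rewrite in_itv /= -{2 3}(fK x) !increasing_inv// ?ltrDl// ltrBlDr ltrDl.
near=> y; have : y \in `](g (f x - e)), (g (f x + e))[.
  by near: y; exact: near_in_itvoo.
rewrite in_itv /= => /andP[/f_incr + /f_incr]; rewrite !gK => ? ?.
by rewrite ltr_norml; lra.
Unshelve. all: by end_near. Qed.

End IncreasingHomeo.

Definition increasing_homeo (R : realType) (f g : R -> R)
    (f_incr : {homo f : x y / (x < y)%R}) (fK : cancel f g) (gK : cancel g f) :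
    homeo R :=
  Homeo fK gK (increasing_continuous f_incr fK gK)
    (increasing_continuous (increasing_inv f_incr gK) gK fK).

Section LodhaMoore.
Local Open Scope ring_scope.
Variable R : realType.
Implicit Types t y : R.

Definition lm_a t : R := t + 1.

Definition lm_b t : R :=
  if t <= 0 then t
  else if t <= 1 / 2 then t / (1 - t)
  else if t <= 1 then 3 - 1 / t
  else t + 1.

Definition lm_c t : R :=
  if (0 <= t) && (t <= 1) then 2 * t / (1 + t) else t.

Definition lm_a_inv y : R := y - 1.

Definition lm_b_inv y : R :=
  if y <= 0 then y
  else if y <= 1 then y / (1 + y)
  else if y <= 2 then 1 / (3 - y)
  else y - 1.

Definition lm_c_inv y : R :=
  if (0 <= y) && (y <= 1) then y / (2 - y) else y.

Lemma lm_a_incr : {homo lm_a : x y / x < y}.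
Proof. by move=> x y xy; rewrite /lm_a ltrD2r. Qed.

Lemma lm_aK : cancel lm_a lm_a_inv.
Proof. by move=> t; rewrite /lm_a /lm_a_inv addrK. Qed.

Lemma lm_a_invK : cancel lm_a_inv lm_a.
Proof. by move=> t; rewrite /lm_a /lm_a_inv subrK. Qed.

(* Case analyses in which every quotient is characterised by a product, so that
   the remaining goals are polynomial. *)

Variant lm_b_spec t : R -> Type :=
| LmB1 of t <= 0 : lm_b_spec t t
| LmB2 z of 0 < t & t <= 1 / 2 & t = z * (1 - t) & 0 < z & z <= 1 : lm_b_spec t z
| LmB3 z of 1 / 2 < t & t <= 1 & 1 = (3 - z) * t & 1 < z & z <= 2 : lm_b_spec t z
| LmB4 of 1 < t : lm_b_spec t (t + 1).

Lemma lm_bP t : lm_b_spec t (lm_b t).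
Proof.
rewrite /lm_b; have [t0|t0] := leP t 0; first by constructor.
have [t1|t1] := leP t (1 / 2).
  have e : t = t / (1 - t) * (1 - t) by rewrite divfK//; lra.
  by constructor=> //; move: e; set z := _ / _ => e; nra.
have [t2|t2] := leP t 1; last by constructor.
have e : 1 = (3 - (3 - 1 / t)) * t by rewrite opprB addrC subrK divfK//; lra.
by constructor=> //; move: e; set z := _ - 1 / _ => e; nra.
Qed.

Variant lm_b_inv_spec y : R -> Type :=
| LmBI1 of y <= 0 : lm_b_inv_spec y y
| LmBI2 z of 0 < y & y <= 1 & y = z * (1 + y) : lm_b_inv_spec y z
| LmBI3 z of 1 < y & y <= 2 & 1 = z * (3 - y) : lm_b_inv_spec y z
| LmBI4 of 2 < y : lm_b_inv_spec y (y - 1).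

Lemma lm_b_invP y : lm_b_inv_spec y (lm_b_inv y).
Proof.
rewrite /lm_b_inv; have [y0|y0] := leP y 0; first by constructor.
have [y1|y1] := leP y 1; first by constructor=> //; rewrite divfK//; lra.
have [y2|y2] := leP y 2; last by constructor.
by constructor=> //; rewrite divfK//; lra.
Qed.

Lemma lm_b_incr : {homo lm_b : x y / x < y}.
Proof.
move=> x y xy.
by case: (lm_bP x) => [?|????? ?|????? ?|?];
  case: (lm_bP y) => [?|????? ?|????? ?|?]; nra.
Qed.

Lemma lm_bK : cancel lm_b lm_b_inv.
Proof.
by move=> t; case: (lm_bP t) => [?|????? ?|????? ?|?];
  case: lm_b_invP => [?|????|????|?]; nra.
Qed.

Lemma lm_b_invK : cancel lm_b_inv lm_b.
Proof.
by move=> y; case: (lm_b_invP y) => [?|????|????|?];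
  case: lm_bP => [?|????? ?|????? ?|?]; nra.
Qed.

Variant lm_c_spec t : R -> Type :=
| LmC1 z of 0 <= t & t <= 1 & 2 * t = z * (1 + t) & 0 <= z & z <= 1 :
    lm_c_spec t z
| LmC2 of t < 0 : lm_c_spec t t
| LmC3 of 1 < t : lm_c_spec t t.

Lemma lm_cP t : lm_c_spec t (lm_c t).
Proof.
rewrite /lm_c; have [t0|t0] /= := leP 0 t; last by constructor.
have [t1|t1] := leP t 1; last by constructor.
have e : 2 * t = 2 * t / (1 + t) * (1 + t) by rewrite divfK//; lra.
by constructor=> //; move: e; set z := _ / _ => e; nra.
Qed.

Variant lm_c_inv_spec y : R -> Type :=
| LmCI1 z of 0 <= y & y <= 1 & y = z * (2 - y) & 0 <= z & z <= 1 :
    lm_c_inv_spec y z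
| LmCI2 of y < 0 : lm_c_inv_spec y y
| LmCI3 of 1 < y : lm_c_inv_spec y y.

Lemma lm_c_invP y : lm_c_inv_spec y (lm_c_inv y).
Proof.
rewrite /lm_c_inv; have [y0|y0] /= := leP 0 y; last by constructor.
have [y1|y1] := leP y 1; last by constructor.
have e : y = y / (2 - y) * (2 - y) by rewrite divfK//; lra.
by constructor=> //; move: e; set z := _ / _ => e; nra.
Qed.

Lemma lm_c_incr : {homo lm_c : x y / x < y}.
Proof.
by move=> x y xy; case: (lm_cP x) => [????? ?|?|?];
  case: (lm_cP y) => [????? ?|?|?]; nra.
Qed.

Lemma lm_cK : cancel lm_c lm_c_inv.
Proof.
by move=> t; case: (lm_cP t) => [????? ?|?|?];
  case: lm_c_invP => [????? ?|?|?]; nra.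
Qed.

Lemma lm_c_invK : cancel lm_c_inv lm_c.
Proof.
by move=> y; case: (lm_c_invP y) => [????? ?|?|?];
  case: lm_cP => [????? ?|?|?]; nra.
Qed.

Definition homeo_a : homeo R := increasing_homeo lm_a_incr lm_aK lm_a_invK.
Definition homeo_b : homeo R := increasing_homeo lm_b_incr lm_bK lm_b_invK.
Definition homeo_c : homeo R := increasing_homeo lm_c_incr lm_cK lm_c_invK.

Definition lodha_moore : groupType :=
  subgroup_type (generated (mem [:: homeo_a; homeo_b; homeo_c])).

End LodhaMoore.

Section ThompsonF.
Local Open Scope ring_scope.
Local Open Scope classical_set_scope.
Variable R : realType.

Definition unit_segment : topologicalType := set_type `[0 : R, 1 : R].

Local Notation I := unit_segment.

Definition coordinate (x : I) : R := set_val x.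

Local Notation "# x" := (coordinate x) (at level 2, right associativity, format "# x").

Definition affine_with (f : I -> I) (m c : R) (u v : I) : Prop :=
  forall x : I, #u <= #x <= #v -> #(f x) = m * #x + c.

Definition affine_on (f : I -> I) (u v : I) : Prop :=
  exists m c : R, affine_with f m c u v.

(* [s] lists finitely many points such that [f] is affine on every segment
   whose interior contains none of them. *)
Definition piecewise_linear (f : I -> I) : Prop :=
  exists s : seq I, forall u v : I, #u < #v ->
    (forall t, t \in s -> ~ (#u < #t < #v)) -> affine_on f u v.

Definition orientation_preserving (f : I -> I) : Prop :=
  forall x y : I, #x < #y -> #(f x) < #(f y).

(* The slope at a point is the derivative there, one-sided at 0 and 1 because
   [I] carries the subspace topology. *)
Definition has_slope (f : I -> I) (x : I) (m : R) : Prop :=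
  (fun y : I => (#(f y) - #(f x)) / (#y - #x)) @ x^' --> m.

Definition breakpoint (f : I -> I) (x : I) : Prop :=
  ~ exists m : R, has_slope f x m.

Definition dyadic (r : R) : Prop :=
  exists (p : int) (n : nat), r = p%:~R / 2 ^+ n.

Definition PLplus (f : I -> I) : Prop :=
  orientation_preserving f /\ piecewise_linear f.

Definition in_thompson_F (f : I -> I) : Prop :=
  [/\ PLplus f,
      forall (x : I) (m : R), has_slope f x m -> exists n : int, m = 2 ^ n
    & forall x : I, breakpoint f x -> dyadic #x].

Definition thompson_F_pred : {pred homeo I} := fun f => `[< in_thompson_F f >].

Lemma coord_itv (x : I) : 0 <= #x <= 1.
Proof. by have := set_valP x; rewrite /= in_itv. Qed.

Lemma coord_inj : injective coordinate.
Proof. exact: val_inj. Qed.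

Lemma coord_surj (r : R) : 0 <= r <= 1 -> exists x : I, #x = r.
Proof.
move=> r01; have rI : r \in (`[0 : R, 1 : R] : set R).
  by rewrite inE /= in_itv.
by exists (exist _ r rI).
Qed.

Lemma nbhs_segment (x : I) (P : set I) :
  nbhs x P <-> exists2 e : R, 0 < e & forall y : I, `|#x - #y| < e -> P y.
Proof.
split.
  rewrite /nbhs/= => -[U /= [[V oV <-] /= Vx] VP].
  have : nbhs (#x) V by exact: open_nbhs_nbhs.
  move=> /nbhs_ballP[e /= e0 eV]; exists e => // y xy.
  by apply: VP => /=; exact: eV.
move=> [e e0 eP]; apply: (@filterS _ _ _ (coordinate @^-1` ball (#x) e)).
  by move=> y; exact: eP.
apply: (@initial_continuous _ _ coordinate x); exact: nbhsx_ballx.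
Qed.

Lemma has_slopeP (f : I -> I) (x : I) (m : R) : has_slope f x m <->
  forall e : R, 0 < e -> exists2 d : R, 0 < d & forall y : I, y != x ->
    `|#x - #y| < d -> `|m - (#(f y) - #(f x)) / (#y - #x)| < e.
Proof.
split.
  move=> /cvgrPdist_lt h e e0; have /nbhs_segment[d d0 dP] := h e e0.
  by exists d => // y yx /dP; exact.
move=> h; apply/cvgrPdist_lt => e /h[d d0 dP].
by apply/nbhs_segment; exists d => // y xy yx; exact: dP.
Qed.

Lemma slope_affine (f : I -> I) (u v x : I) (m c d : R) :
  #u < #v -> #u <= #x <= #v -> affine_with f m c u v -> has_slope f x d -> d = m.
Proof.
move=> uv xuv fA /has_slopeP fx; apply/eqP; rewrite -subr_eq0 -normr_eq0.
rewrite eq_le normr_ge0 andbT leNgt; apply/negP => /fx[e e0 eP].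
have /andP[ux xv] := xuv.
have [/andP[? ?] /andP[? ?]] := (coord_itv u, coord_itv v).
have [y yx [yuv yd]] : exists2 y : I, y != x & #u <= #y <= #v /\ `|#x - #y| < e.
  have [xlv|vx] := ltP (#x) (#v).
    pose w := Num.min (e / 2) (#v - #x).
    have w0 : 0 < w by rewrite lt_min; apply/andP; split; lra.
    have we : w <= e / 2 by rewrite ge_min lexx.
    have wv : w <= #v - #x by rewrite ge_min lexx orbT.
    have [y yE] : exists y : I, #y = #x + w by apply: coord_surj; apply/andP; split; lra.
    exists y; first by apply/eqP => /(congr1 coordinate); rewrite yE; lra.
    by rewrite yE; split; [lra | rewrite ltr_norml; lra].
  pose w := Num.min (e / 2) (#x - #u).
  have w0 : 0 < w by rewrite lt_min; apply/andP; split; lra.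
  have we : w <= e / 2 by rewrite ge_min lexx.
  have wv : w <= #x - #u by rewrite ge_min lexx orbT.
  have [y yE] : exists y : I, #y = #x - w by apply: coord_surj; apply/andP; split; lra.
  exists y; first by apply/eqP => /(congr1 coordinate); rewrite yE; lra.
  by rewrite yE; split; [lra | rewrite ltr_norml; lra].
have := eP y yx yd; rewrite (fA y yuv) (fA x xuv).
have -> : m * #y + c - (m * #x + c) = m * (#y - #x) by ring.
by rewrite mulfK ?ltxx// subr_eq0; apply: contra_neq yx => /coord_inj.
Qed.

Lemma affine_slope (f : I -> I) (u v x : I) (m c : R) :
  #u < #x < #v -> affine_with f m c u v -> has_slope f x m.
Proof.
move=> /andP[ux xv] fA; apply/has_slopeP => e e0.
exists (Num.min (#x - #u) (#v - #x)); first by rewrite lt_min; apply/andP; split; lra.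
move=> y yx; rewrite lt_min !ltr_norml => /andP[/andP[? ?] /andP[? ?]].
rewrite (fA y) ?(fA x); [|lra..].
have -> : m * #y + c - (m * #x + c) = m * (#y - #x) by ring.
rewrite mulfK ?subrr ?oppr_lt0 ?e0//.
by rewrite subr_eq0; apply: contra_neq yx => /coord_inj.
Qed.

Lemma dyadicD r q : dyadic r -> dyadic q -> dyadic (r + q).
Proof.
move=> [p [n ->]] [p' [n' ->]].
exists (p * 2 ^+ n' + p' * 2 ^+ n)%R, (n + n')%N.
rewrite rmorphD !rmorphM !rmorphXn /= exprD.
by field; rewrite !expf_neq0 ?pnatr_eq0.
Qed.

Lemma dyadicM r q : dyadic r -> dyadic q -> dyadic (r * q).
Proof.
move=> [p [n ->]] [p' [n' ->]]; exists (p * p')%R, (n + n')%N.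
by rewrite rmorphM /= exprD; field; rewrite !expf_neq0 ?pnatr_eq0.
Qed.

Lemma dyadic_int (p : int) : dyadic p%:~R.
Proof. by exists p, 0%N; rewrite expr0 divr1. Qed.

Lemma dyadicN r : dyadic r -> dyadic (- r).
Proof. by rewrite -mulN1r; apply: dyadicM; exact: (dyadic_int (-1)). Qed.

Lemma dyadic_pow2 (k : int) : dyadic (2 ^ k).
Proof.
case: k => n; first by exists (2 ^+ n)%R, 0%N; rewrite rmorphXn /= expr0 divr1.
by exists 1, n.+1; rewrite NegzE -exprnN mul1r.
Qed.

Definition missing (s : seq I) (u v : I) : Prop :=
  forall t, t \in s -> ~ (#u < #t < #v).

(* Used only to prove that [in_thompson_F] is closed under the group operations;
   equivalent to it by [thompson_F_pieces] and [pieces_thompson_F]. *)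
Definition dyadic_pieces (f : I -> I) : Prop :=
  exists2 s : seq I, forall t, t \in s -> dyadic #t
    & forall u v : I, #u < #v -> missing s u v ->
        exists (k : int) (c : R), affine_with f (2 ^ k) c u v.

Lemma affine_glue (f : I -> I) (p : I) (s : seq I) :
  (exists m, has_slope f p m) ->
  (forall u v, #u < #v -> missing (p :: s) u v -> affine_on f u v) ->
  forall u v, #u < #v -> missing s u v -> affine_on f u v.
Proof.
move=> [d fp] fA u v uv suv.
have [/andP[up pv]|nuv] := boolP (#u < #p < #v); last first.
  by apply: fA => // t; rewrite inE => /predU1P[->|/suv//]; apply/negP.
have [|m [c mA]] := fA u p up.
  move=> t; rewrite inE => /predU1P[->|/suv]; first by rewrite ltxx andbF.
  by move=> + /andP[ut tp]; apply; rewrite ut (lt_trans tp).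
have [|m' [c' mA']] := fA p v pv.
  move=> t; rewrite inE => /predU1P[->|/suv]; first by rewrite ltxx.
  by move=> + /andP[pt tv]; apply; rewrite tv (lt_trans up).
have dm : d = m by apply: (slope_affine up _ mA fp); rewrite lexx ltW.
have dm' : d = m' by apply: (slope_affine pv _ mA' fp); rewrite lexx ltW.
have e : m * #p + c = m' * #p + c'.
  by rewrite -(mA p) ?(mA' p)// lexx ltW.
subst m m'; exists d, c => x /andP[ux xv].
have [xp|px] := leP (#x) (#p); first by rewrite (mA x)// ux.
by rewrite (mA' x) ?xv ?(ltW px)//; move/addrI: e => ->.
Qed.

Lemma thompson_F_pieces (f : I -> I) : in_thompson_F f -> dyadic_pieces f.
Proof.
move=> [[_ [s sA]] slopes bpts].
have [s' s'D s'A] : exists2 s' : seq I, forall t, t \in s' -> dyadic #t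
    & forall u v, #u < #v -> missing s' u v -> affine_on f u v.
  have : exists2 s' : seq I, forall t, t \in s' -> dyadic #t
      & forall u v, #u < #v -> missing (s ++ s') u v -> affine_on f u v.
    by exists [::] => //; rewrite cats0.
  elim: s {sA} => [//|p s IH] [s' s'D s'A]; apply: IH.
  have [pD|pD] := pselect (dyadic #p).
    exists (p :: s').
      by move=> t; rewrite inE => /predU1P[->|]; [exact: pD | exact: s'D].
    move=> u v uv suv; apply: s'A => // t; rewrite inE mem_cat orbA => h.
    by apply: suv; rewrite mem_cat inE orbCA orbA.
  exists s' => //; apply: affine_glue s'A.
  by apply: contrapT => /bpts.
exists s' => // u v uv /(s'A u v uv)[m [c mA]].
have [/andP[? ?] /andP[? ?]] := (coord_itv u, coord_itv v).
have [x xE] : exists x : I, #x = (#u + #v) / 2.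
  by apply: coord_surj; apply/andP; split; lra.
have [|k mk] := slopes x m.
  by apply: (affine_slope (u := u) (v := v)) mA; rewrite xE; lra.
by exists k, c; rewrite -mk.
Qed.

Lemma gap_right (s : seq I) (x : I) :
  #x < 1 -> exists2 v : I, #x < #v & missing s x v.
Proof.
move=> x1; elim: s => [|t s [v xv sv]].
  by have [v v1] := @coord_surj 1 (introT andP (conj ler01 (lexx _)));
    exists v; rewrite ?v1.
have [/andP[xt tv]|ntv] := boolP (#x < #t < #v); last first.
  by exists v => // r; rewrite inE => /predU1P[->|/sv//]; exact/negP.
exists t => // r; rewrite inE => /predU1P[->|/sv]; first by rewrite ltxx andbF.
by move=> + /andP[xr rt]; apply; rewrite xr (lt_trans rt).
Qed.

Lemma gap_left (s : seq I) (x : I) :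
  0 < #x -> exists2 u : I, #u < #x & missing s u x.
Proof.
move=> x0; elim: s => [|t s [u ux su]].
  by have [u u0] := @coord_surj 0 (introT andP (conj (lexx _) ler01));
    exists u; rewrite ?u0.
have [/andP[ut tx]|ntv] := boolP (#u < #t < #x); last first.
  by exists u => // r; rewrite inE => /predU1P[->|/su//]; exact/negP.
exists t => // r; rewrite inE => /predU1P[->|/su]; first by rewrite ltxx.
by move=> + /andP[tr rx]; apply; rewrite rx (lt_trans ut).
Qed.

Lemma pieces_thompson_F (f : I -> I) :
  orientation_preserving f -> dyadic_pieces f -> in_thompson_F f.
Proof.
move=> fO [s sD sA]; split.
- split=> //; exists s => u v uv /(sA u v uv)[k [c kA]].
  by exists (2 ^ k), c.
- move=> x m fx.
  have [u [v [uv suv xuv]]] : exists u v : I,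
      [/\ #u < #v, missing s u v & #u <= #x <= #v].
    have [x1|x1] := ltP (#x) 1.
      by have [v xv sv] := gap_right s x1; exists x, v; rewrite lexx ltW.
    have [|u ux su] := @gap_left s x; first by lra.
    by exists u, x; rewrite lexx ltW.
  have [k [c kA]] := sA u v uv suv.
  by exists k; exact: slope_affine uv xuv kA fx.
- move=> x; apply: contra_notP => xD.
  have /andP[x0 x1] := coord_itv x.
  have [|v xv sv] := @gap_right s x.
    rewrite lt_neqAle x1 andbT; apply: contra_notN xD => /eqP ->.
    exact: (dyadic_int 1).
  have [|u ux su] := @gap_left s x.
    rewrite lt_neqAle x0 andbT; apply: contra_notN xD => /eqP <-.
    exact: (dyadic_int 0).
  have [|t ts /andP[ut tv]|k [c kA]] := sA u v; first exact: lt_trans xv.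
    have [tx|xt|/coord_inj tx] := ltgtP (#t) (#x).
    + by apply: (su t ts); rewrite ut.
    + by apply: (sv t ts); rewrite xt.
    + by apply: xD; rewrite -tx; exact: sD.
  by exists (2 ^ k); apply: affine_slope kA; rewrite ux.
Qed.

Implicit Types f g h : homeo I.

Lemma opV f : orientation_preserving f -> orientation_preserving (homeo_inv f).
Proof.
move=> fO x y xy; rewrite ltNge; apply/negP; rewrite le_eqVlt => /orP[/eqP|].
  move=> /coord_inj /(congr1 f); rewrite !homeo_invK => e.
  by move: xy; rewrite e ltxx.
by move=> /fO; rewrite !homeo_invK => /(lt_trans xy); rewrite ltxx.
Qed.

Lemma opM (f g : I -> I) : orientation_preserving f ->
  orientation_preserving g -> orientation_preserving (f \o g).
Proof. by move=> fO gO x y /gO/fO. Qed.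

Lemma op_lt f : orientation_preserving f ->
  forall x y, (#(f x) < #(f y)) = (#x < #y).
Proof.
move=> fO x y; apply/idP/idP => [/(opV fO)|/fO//].
by rewrite !homeo_funK.
Qed.

Lemma op_le f : orientation_preserving f ->
  forall x y, (#(f x) <= #(f y)) = (#x <= #y).
Proof. by move=> fO x y; rewrite !leNgt op_lt. Qed.

Lemma lt_count (T : eqType) (p q : pred T) (t : T) (s : seq T) :
  subpred p q -> ~~ p t -> q t -> t \in s -> (count p s < count q s)%N.
Proof.
move=> pq pt qt; elim: s => // a s IH.
rewrite inE /= => /predU1P[<-|/IH ts].
  by rewrite (negPf pt) qt add0n add1n ltnS sub_count.
by rewrite -addnS leq_add//; case: (p a) (pq a) => // ->.
Qed.

Lemma pieces_diff (f : I -> I) : dyadic_pieces f ->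
  forall u v : I, #u < #v -> dyadic #u -> dyadic #v -> dyadic (#(f v) - #(f u)).
Proof.
move=> [s sD sA]; pose N u v := count (fun t : I => #u < #t < #v) s.
suff H n u v : (N u v < n)%N -> #u < #v -> dyadic #u -> dyadic #v ->
    dyadic (#(f v) - #(f u)) by move=> u v; exact: (H (N u v).+1).
elim: n u v => // n IH u v Nn uv uD vD.
have [/hasP[t ts /andP[ut tv]]|/hasPn h] :=
    boolP (has (fun t : I => #u < #t < #v) s).
  have -> : #(f v) - #(f u) = (#(f v) - #(f t)) + (#(f t) - #(f u)).
    by rewrite addrA subrK.
  apply: dyadicD; apply: IH => //; try exact: sD;
    apply: leq_trans (_ : N u v <= n)%N => //; apply: (lt_count _ _ _ ts);
    rewrite ?ltxx ?andbF ?ut// => r /andP[? ?].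
  - by rewrite (lt_trans ut).
  - by apply/andP; split=> //; exact: lt_trans tv.
have [|k [c kA]] := sA u v uv; first by move=> t /h/negP.
rewrite (kA v) ?(kA u) ?lexx ?ltW//.
have -> : 2 ^ k * #v + c - (2 ^ k * #u + c) = 2 ^ k * (#v - #u) by ring.
by apply: dyadicM; [exact: dyadic_pow2 | apply: dyadicD => //; exact: dyadicN].
Qed.

Lemma pieces_dyadic f : orientation_preserving f -> dyadic_pieces f ->
  forall x : I, dyadic #x -> dyadic #(f x).
Proof.
move=> fO fP x xD.
have [z z0] := @coord_surj 0 (introT andP (conj (lexx _) ler01)).
have fz : #(f z) = 0.
  apply/eqP; rewrite eq_le andbC; have /andP[-> _] := coord_itv (f z).
  have : #(f z) <= #(f (homeo_inv f z)).
    by rewrite op_le// z0; have /andP[] := coord_itv (homeo_inv f z).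
  by rewrite homeo_invK z0 => ->.
have /andP[+ _] := coord_itv x; rewrite le_eqVlt => /orP[/eqP x0|x0].
  have -> : x = z by apply: coord_inj; rewrite z0.
  by rewrite fz; exact: (dyadic_int 0).
rewrite -[#(f x)]subr0 -fz; apply: pieces_diff => //; rewrite z0//.
exact: (dyadic_int 0).
Qed.

Lemma piecesV f : orientation_preserving f -> dyadic_pieces f ->
  dyadic_pieces (homeo_inv f).
Proof.
move=> fO fP; have [s sD sA] := fP; exists (map f s).
  by move=> _ /mapP[t ts ->]; apply: pieces_dyadic => //; exact: sD.
move=> u v uv suv.
have [||k [c kA]] := sA (homeo_inv f u) (homeo_inv f v).
- exact: opV.
- by move=> t ts; rewrite -(op_lt fO) -(op_lt fO t) !homeo_invK; apply/suv/map_f.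
exists (- k), (- (2 ^ (- k) * c)) => x xuv.
have := kA (homeo_inv f x); rewrite -(op_le fO) -(op_le fO _ (homeo_inv f v)) !homeo_invK => /(_ xuv) ->.
rewrite mulrDr mulrA -expfzDr ?pnatr_eq0// addNr expr0z mul1r.
by rewrite addrK.
Qed.

Lemma piecesM f g : orientation_preserving f -> orientation_preserving g ->
  dyadic_pieces f -> dyadic_pieces g -> dyadic_pieces (f \o g).
Proof.
move=> fO gO [s sD sA] gP; have [r rD rA] := gP.
exists (r ++ map (homeo_inv g) s).
  move=> t; rewrite mem_cat => /orP[/rD//|/mapP[w ws ->]].
  by apply: (@pieces_dyadic (g^-1)%g);
    [exact: opV | exact: piecesV | exact: sD].
move=> u v uv suv.
have [|k [c kA]] := rA u v uv.
  by move=> t tr; apply: suv; rewrite mem_cat tr.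
have [||l [d lA]] := sA (g u) (g v).
- exact: gO.
- move=> t ts; rewrite -(homeo_invK g t) !(op_lt gO); apply: suv.
  by rewrite mem_cat map_f ?orbT.
exists (l + k), (2 ^ l * c + d) => x xuv /=.
rewrite (lA (g x)) ?(op_le gO)// (kA x xuv) mulrDr mulrA -expfzDr ?pnatr_eq0//.
by rewrite addrA.
Qed.

Lemma thompson_F1 : 1%g \in thompson_F_pred.
Proof.
apply/asboolP; apply: pieces_thompson_F => //; exists [::] => // u v _ _.
by exists 0, 0 => x _; rewrite expr0z mul1r addr0.
Qed.

Lemma thompson_FM : mulg_closed thompson_F_pred.
Proof.
move=> f g /asboolP fF /asboolP gF; apply/asboolP; apply: pieces_thompson_F.
  by case: fF gF => -[fO _] _ _ [[gO _] _ _]; exact: opM.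
by apply: piecesM; try exact: thompson_F_pieces; [case: fF => -[] | case: gF => -[]].
Qed.

Lemma thompson_FV : invg_closed thompson_F_pred.
Proof.
move=> f /asboolP fF; have fO : orientation_preserving f by case: fF => -[].
apply/asboolP; apply: pieces_thompson_F; first exact: opV.
by apply: piecesV => //; exact: thompson_F_pieces.
Qed.

HB.instance Definition _ := isMulClosed.Build (homeo I) thompson_F_pred thompson_FM.
HB.instance Definition _ := isMul1Closed.Build (homeo I) thompson_F_pred thompson_F1.
HB.instance Definition _ := isInvClosed.Build (homeo I) thompson_F_pred thompson_FV.

Definition thompson_F : groupType := subgroup_type thompson_F_pred.

End ThompsonF.

(* Main.v *)
From HB Require Import structures.
Require Import Defs.
From mathcomp Require Import all_boot all_order all_algebra.
From mathcomp Require Import all_classical all_reals all_analysis.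
From mathcomp Require Import ring lra.

(* Both groups act on the line by increasing homeomorphisms, and their elements
   have, on either side of a fixed point (including the two infinities), a germ
   that is affine in a suitable coordinate.  Let G be a finitely generated
   subgroup and phi : G -> J a surjection onto a just infinite group that is not
   virtually abelian.  Since the affine group is metabelian, the double
   commutators of G are trivial near the global fixed points of G.  If phi does
   not kill them, the normal subgroup M that their images generate has finite
   index, so by Schreier's lemma M = phi(P) for a group P generated by finitely
   many products of double commutators.  All of P is trivial near the global
   fixed points, so by compactness it moves points in only finitely many
   components of their complement.  On one such component some h in G pushes
   the support of P off itself, so the commutators [p, h q h^-1] with p, q in P
   are trivial there, while their images are all the commutators of M.  By
   induction on the number of components these images are trivial; so M is an
   abelian normal subgroup, hence trivial.  Therefore phi kills the double
   commutators, J is metabelian, and the same remark makes it trivial. *)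

Set Implicit Arguments.
Unset Strict Implicit.
Unset Printing Implicit Defensive.

Import Order.TTheory GRing.Theory Num.Theory.
Import numFieldNormedType.Exports.

(** * Subgroups given by generators, and Schreier's lemma *)

Section Generation.
Local Open Scope group_scope.
Local Open Scope classical_set_scope.
Variable G : groupType.

Lemma groupClosed_of (P : set G) :
  P 1 -> (forall x y, P x -> P y -> P (x * y)) -> (forall x, P x -> P x^-1) ->
  exists K : groupClosed G, forall x, (x \in K) = (x \in P).
Proof.
move=> P1 PM PV; pose S : {pred G} := fun x => x \in P.
have SM : mulg_closed S.
  by move=> x y /set_mem Px /set_mem Py; apply/mem_set/PM.
have S1 : 1 \in S by apply/mem_set.
have SV : invg_closed S by move=> x /set_mem Px; apply/mem_set/PV.
pose mM := isMulClosed.Build G S SM.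
pose m1 := isMul1Closed.Build G S S1.
pose mV := isInvClosed.Build G S SV.
pose K : groupClosed G := HB.pack S mM m1 mV.
by exists K.
Qed.

Lemma mem_generated (S : {pred G}) : {subset S <= generated S}.
Proof. by move=> x xS; apply/asboolP => K; exact. Qed.

Lemma generated_sub (S : {pred G}) (K : groupClosed G) :
  {subset S <= K} -> {subset generated S <= K}.
Proof. by move=> SK x /asboolP; exact. Qed.

Lemma generated_ind (S : {pred G}) (P : set G) :
  P 1 -> (forall x y, P x -> P y -> P (x * y)) -> (forall x, P x -> P x^-1) ->
  (forall x, x \in S -> P x) -> forall x, x \in generated S -> P x.
Proof.
move=> P1 PM PV SP x xS; have [K KP] := groupClosed_of P1 PM PV.
have : x \in K.
  by apply: (generated_sub _ xS) => y yS; rewrite KP; apply/mem_set/SP.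
by rewrite KP => /set_mem.
Qed.

Definition conj_stable (S : set G) := forall x y : G, S x -> S (x ^ y).

Lemma generated_normal (S : set G) :
  conj_stable S -> normal_subgroup (generated (mem S)).
Proof.
move=> Sconj x y; move: x.
apply: (@generated_ind _ [set x | x ^ y \in generated (mem S)]) => /=.
- by rewrite conj1g gpred1.
- by move=> x z xS zS; rewrite conjMg gpredM.
- by move=> x xS; rewrite conjVg gpredV.
- by move=> x /set_mem xS; apply/mem_generated/mem_set/Sconj.
Qed.

Lemma generated_abelian (S : {pred G}) :
  {in S &, forall x y, commute x y} ->
  {in generated S &, forall x y, commute x y}.
Proof.
have centralizer (T : {pred G}) y : {in T, forall x, commute y x} ->
    {in generated T, forall x, commute y x}.
  move=> yT; apply: (@generated_ind _ (commute y)) => //.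
  - exact: commute1.
  - by move=> *; exact: commuteM.
  - by move=> *; exact: commuteV.
move=> SS x y xS yS; apply: (centralizer S) yS => z zS.
apply: commute_sym; apply: (centralizer S) xS => w wS; exact: SS.
Qed.

Lemma conj_stable_commutators (A B : set G) : conj_stable A -> conj_stable B ->
  conj_stable [set [~ x, y] | x in A & y in B].
Proof.
move=> Ac Bc _ z [x Ax [y By <-]]; rewrite conjRg.
by exists (x ^ z); [exact: Ac | exists (y ^ z); [exact: Bc|]].
Qed.

(** A nontrivial [S] would generate a normal subgroup of finite index, which is abelian because its
    generators commute. *)
Lemma abelian_normal_trivial (S : set G) :
  just_infinite G -> ~ virtually_abelian G -> conj_stable S ->
  (forall x y, S x -> S y -> commute x y) -> forall x, S x -> x = 1.
Proof.
move=> jiG nva Sconj Scomm x Sx; apply: contrapT => x1; apply: nva.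
exists (generated (mem S) : groupClosed G).
  apply: jiG (generated_normal Sconj) _.
  by exists x; [exact/mem_generated/mem_set | exact/eqP].
by apply: generated_abelian => y z /set_mem ? /set_mem ?; exact: Scomm.
Qed.

(** The generators are Schreier's [u^-1 * g * t]. As [T] merely covers the cosets and need not
    contain 1, its members lying in [N] are added. *)
Lemma schreier (N : groupClosed G) :
  finitely_generated G -> finite_index N ->
  exists2 r : seq G, {subset r <= N} & {subset N <= generated (mem r)}.
Proof.
move=> [s sG] [T TN].
pose gens := [seq u^-1 * v | u <- T, v <- [seq g * t | g <- s ++ [seq g^-1 | g <- s], t <- T]].
pose r := [seq x <- gens ++ T | x \in N].
exists r => [x|]; first by rewrite mem_filter => /andP[].
pose K := generated (mem r).
(* [Q x] says that [x] maps the union of the cosets [t K], for [t] in [T], into itself. *)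
pose Q := [set x : G | forall t, t \in T -> exists2 u, u \in T & u^-1 * (x * t) \in K].
have Qs x : x \in s ++ [seq g^-1 | g <- s] -> Q x.
  move=> xs t tT; have [u uT uN] := TN (x * t); exists u => //.
  apply: mem_generated; change (u^-1 * (x * t) \in r).
  rewrite mem_filter uN mem_cat; apply/orP; left.
  by apply: allpairs_f => //; apply: allpairs_f.
have QM x y : Q x -> Q y -> Q (x * y).
  move=> Qx Qy t /Qy[u /Qx[v vT vK] uK]; exists v => //.
  have -> : v^-1 * (x * y * t) = v^-1 * (x * u) * (u^-1 * (y * t)).
    by rewrite !mulgA mulgK.
  by apply: gpredM.
have QT x : Q x.
  (* [Q] is not visibly closed under inverses, so [Q x^-1] is carried along in the induction. *)
  suff : (Q `&` [set x | Q x^-1]) x by case.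
  have := sG x; move: x; apply: generated_ind => /=.
  - by split=> /=; rewrite ?invg1 => t tT; exists t => //; rewrite mul1g mulVg gpred1.
  - by move=> x y [Qx Qx'] [Qy Qy']; split => /=; [exact: QM | rewrite invgM; exact: QM].
  - by move=> x [Qx Qx']; split => //=; rewrite invgK.
  - by move=> x xs; split; apply: Qs; rewrite mem_cat ?xs// map_f ?orbT.
have TK t : t \in T -> t \in N -> t \in K.
  by move=> tT tN; apply: mem_generated; change (t \in r); rewrite mem_filter tN mem_cat tT orbT.
have KN : {subset K <= N}.
  by apply: generated_sub => x; change (x \in r -> x \in N); rewrite mem_filter => /andP[].
(* The member of [T] that covers 1 lies in [N], hence in [K]; it serves to write [x] as a product of
   three elements of [K]. *)
move=> x xN; have [t tT] := TN 1; rewrite mulg1 gpredV => tN.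
have [u uT uxt] := QT x t tT.
have uN : u \in N.
  by have := KN _ uxt; rewrite gpredMr ?gpredV// gpredM.
have -> : x = u * (u^-1 * (x * t)) / t by rewrite mulVKg mulgK.
by apply: gpredF; [apply: gpredM => //|]; exact: TK.
Qed.

End Generation.

(** * Morphisms and images of generated subgroups *)

Section Surjections.
Local Open Scope group_scope.
Local Open Scope classical_set_scope.
Variables (G J : groupType) (phi : {multiplicative G -> J}).

Lemma morph1 : phi 1 = 1.
Proof. by apply: (mulgI (phi 1)); rewrite -gmulfM !mulg1. Qed.

Lemma morphV x : phi x^-1 = (phi x)^-1.
Proof. by apply: esym; apply: mulg1_eq; rewrite -gmulfM mulgV morph1. Qed.

Lemma morphJ x y : phi (x ^ y) = phi x ^ phi y.
Proof. by rewrite !conjgE !gmulfM morphV. Qed.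

Lemma morphR x y : phi [~ x, y] = [~ phi x, phi y].
Proof. by rewrite !commgEl gmulfM morphV morphJ. Qed.

Lemma generated_image (S : set G) :
  phi @` [set` generated (mem S)] = [set` generated (mem (phi @` S))].
Proof.
apply/seteqP; split => [_ [x + <-]|].
  move: x; apply: (@generated_ind _ _
    [set x | phi x \in generated (mem (phi @` S))]) => /=.
  - by rewrite morph1 gpred1.
  - by move=> x y xS yS; rewrite gmulfM gpredM.
  - by move=> x xS; rewrite morphV gpredV.
  - by move=> x /set_mem xS; apply/mem_generated/mem_set/imageP.
apply: generated_ind => [|x y [a aS <-] [b bS <-]|x [a aS <-]|y /set_mem[a aS <-]].
- by exists 1; [rewrite /= gpred1 | rewrite morph1].
- by exists (a * b); [rewrite /= gpredM | rewrite gmulfM].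
- by exists a^-1; [rewrite /= gpredV | rewrite morphV].
- by apply: imageP => /=; apply/mem_generated/mem_set.
Qed.

Lemma conj_stable_image (S : set G) : (forall y : J, exists x, phi x = y) ->
  conj_stable S -> conj_stable (phi @` S).
Proof.
move=> phi_surj Sconj _ z [x Sx <-]; have [y <-] := phi_surj z.
by rewrite -morphJ; exact/imageP/Sconj.
Qed.

Lemma finitely_generated_image : (forall y : J, exists x, phi x = y) ->
  finitely_generated G -> finitely_generated J.
Proof.
move=> phi_surj [s sG]; exists (map phi s) => y; have [x <-] := phi_surj y.
have := sG x; move: x; apply: (@generated_ind _ _
    [set x | phi x \in generated (mem (map phi s))]) => /=.
- by rewrite morph1 gpred1.
- by move=> x z xS zS; rewrite gmulfM gpredM.
- by move=> x xS; rewrite morphV gpredV.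
- by move=> x xs; apply: mem_generated; exact: map_f.
Qed.

End Surjections.

(** * Affine germs along an invariant filter *)

Section Germs.
Local Open Scope group_scope.
Local Open Scope classical_set_scope.
Variables (G : groupType) (T : Type) (act : G -> T -> T).
Hypotheses (act1 : forall t, act 1 t = t).
Hypotheses (actM : forall g h t, act (g * h) t = act g (act h t)).
Variables (F : set_system T) (FF : Filter F).
Hypothesis F_act : forall g A, F A -> F [set t | A (act g t)].
Variables (K : fieldType) (u : T -> K).

Definition affine_germ (g : G) (m c : K) : Prop :=
  m != 0%R /\ F [set t | u (act g t) = (m * u t + c)%R].

Lemma affine_germM g h m c m' c' : affine_germ g m c -> affine_germ h m' c' ->
  affine_germ (g * h) (m * m')%R (m * c' + c)%R.
Proof.
move=> [m0 gA] [m'0 hA]; split; first by rewrite mulf_neq0.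
apply: filterS2 (F_act h gA) hA => t /=; rewrite actM => -> ->.
by rewrite mulrDr mulrA addrA.
Qed.

Lemma affine_germV g m c : affine_germ g m c ->
  affine_germ g^-1 m^-1%R (- (m^-1 * c))%R.
Proof.
move=> [m0 gA]; split; first by rewrite invr_neq0.
apply: filterS (F_act g^-1 gA) => t /=; rewrite -actM mulgV act1 => ->.
by rewrite mulrDr mulrA mulVf// mul1r addrK.
Qed.

(** Multipliers lie in a commutative group, so that of a commutator is 1: its germ is a translation
    in the coordinate [u]. *)
Lemma affine_germR g h m c m' c' : affine_germ g m c -> affine_germ h m' c' ->
  affine_germ [~ g, h] 1%R (m^-1 * (m'^-1 * (m * c' + c - c') - c))%R.
Proof.
move=> gA hA; have [m0 _] := gA; have [m'0 _] := hA.
have := affine_germM (affine_germV gA)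
  (affine_germM (affine_germV hA) (affine_germM gA hA)).
rewrite commgEl conjgE.
congr affine_germ; field; rewrite ?m0 ?m'0//.
Qed.

(* The affine group is metabelian. *)
Lemma double_commutator_germ (B : set T) :
  F B -> {in B &, injective u} ->
  (forall g, exists m c, affine_germ g m c) ->
  forall a b c d, F [set t | act [~ [~ a, b], [~ c, d]] t = t].
Proof.
move=> FB u_inj germs a b c d.
have [ma [ca aA]] := germs a; have [mb [cb bA]] := germs b.
have [mc [cc cA]] := germs c; have [md [cd dA]] := germs d.
have [_ ] := affine_germR (affine_germR aA bA) (affine_germR cA dA).
set g := [~ _, _] => gA.
apply: filterS3 gA FB (F_act g FB) => t /= ut Bt Bgt.
by apply: u_inj; [exact/mem_set.. | rewrite ut invr1; ring].
Qed.

End Germs.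

(** * Groups of increasing bijections of a complete linear order *)

Section Dynamics.
Local Open Scope group_scope.
Local Open Scope classical_set_scope.
Local Open Scope order_scope.
Variables (d : Order.disp_t) (X : orderType d).

Definition is_sup (A : set X) (m : X) : Prop :=
  (forall x, A x -> x <= m) /\ forall y, (forall x, A x -> x <= y) -> m <= y.

Lemma lt_is_sup A m y : is_sup A m -> y < m -> exists2 x, A x & y < x.
Proof.
move=> [_ m_le] ym; apply: contrapT => h; move: ym; apply/negP; rewrite -leNgt.
by apply: m_le => x Ax; rewrite leNgt; apply/negP => yx; apply: h; exists x.
Qed.

Definition toward (b : bool) (x y : X) : bool := if b then x < y else y < x.

(* One-sided punctured neighbourhoods: [side true x] is to the right of [x].
   When there is nothing on that side, every set belongs to the filter. *)
Definition side (b : bool) (x : X) : set_system X :=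
  [set A : set X | forall w, toward b x w -> exists2 r, toward b x r &
    forall t, toward b x t -> toward b t r -> A t].

Lemma side_filter b x : Filter (side b x).
Proof.
split.
- by move=> w xw; exists w.
- move=> A B xA xB w xw.
  have [[r xr rA] [s xs sB]] := (xA w xw, xB w xw).
  have [q xq qrs] : exists2 q, toward b x q &
      forall t, toward b t q -> toward b t r /\ toward b t s.
    case: b {xA xB xw rA sB} xr xs => /= xr xs.
      by exists (Order.min r s) => [|t]; rewrite lt_min; [rewrite xr | move/andP].
    by exists (Order.max r s) => [|t]; rewrite gt_max; [rewrite xr | move/andP].
  by exists q => // t xt /qrs[tr ts]; split; [exact: rA | exact: sB].
- by move=> A B AB xA w /xA[r xr rA]; exists r => // t xt tr; apply/AB/rA.
Qed.
#[local] Existing Instance side_filter.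

(** Since all sets are allowed, this also gives a least and a greatest element: [X] is compact in
    its order topology. *)
Hypothesis sup_exists : forall A : set X, exists m, is_sup A m.
Variables (G : groupType) (act : G -> X -> X).
Hypotheses (act1 : forall t, act 1 t = t).
Hypotheses (actM : forall g h t, act (g * h) t = act g (act h t)).
Hypothesis act_homo : forall g, {homo act g : x y / x < y}.
Hypothesis act_faithful : forall g, (forall t, act g t = t) -> g = 1.

Lemma actK g : cancel (act g) (act g^-1).
Proof. by move=> t; rewrite -actM mulVg act1. Qed.

Lemma actVK g : cancel (act g^-1) (act g).
Proof. by move=> t; rewrite -actM mulgV act1. Qed.

Lemma act_lt g : {mono act g : x y / x < y}.
Proof. by move=> x y; apply/idP/idP => /act_homo; [move=> /(_ g^-1); rewrite !actK | exact]. Qed.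

Lemma act_le g : {mono act g : x y / x <= y}.
Proof. by move=> x y; rewrite !leNgt act_lt. Qed.

Lemma actV_fix g t : act g t = t -> act g^-1 t = t.
Proof. by move=> gt; rewrite -[in LHS]gt actK. Qed.

Lemma actR_fix g h t : act g t = t -> act h t = t -> act [~ g, h] t = t.
Proof.
move=> gt ht; rewrite commgEl conjgE !actM ht gt.
by rewrite (actV_fix ht) (actV_fix gt).
Qed.

Definition fixed (x : X) : Prop := forall g, act g x = x.

(** Each [act g m] is at least [m], by invariance of [A]; applying this to [g^-1] gives the reverse
    inequality. *)
Lemma fixed_sup (A : set X) m :
  (forall g x, A x -> A (act g x)) -> is_sup A m -> fixed m.
Proof.
move=> AG [Am m_le].
have le_act g : m <= act g m.
  by apply: m_le => x Ax; rewrite -[x](actVK g) act_le; exact/Am/AG.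
move=> g; apply: le_anti; rewrite le_act andbT.
by rewrite -(act_le g^-1) actK.
Qed.

Lemma toward_act b g x t : fixed x -> toward b x (act g t) = toward b x t.
Proof. by move=> xfix; rewrite -[x in LHS](xfix g); case: b => /=; rewrite act_lt. Qed.

Lemma side_act b x g A : fixed x -> side b x A -> side b x [set t | A (act g t)].
Proof.
move=> xfix xA w /xA[r xr rA]; exists (act g^-1 r); first by rewrite toward_act.
move=> t xt tr; apply: rA; first by rewrite toward_act.
by rewrite -[r](actVK g); case: b {xA xr xt} tr => /=; rewrite act_lt.
Qed.

(** Components of the complement of the global fixed points, described by position relative to these
    points; a fixed point is a class of its own. *)
Definition same_component (x y : X) : Prop :=
  forall z, fixed z -> (z < x) = (z < y) /\ (x < z) = (y < z).

Lemma same_component_act g x : same_component x (act g x).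
Proof.
by move=> z zfix; rewrite -{2 4}(zfix g) !act_lt.
Qed.

Lemma same_component_sym x y : same_component x y -> same_component y x.
Proof. by move=> xy z /xy[-> ->]. Qed.

Lemma same_component_trans x y z :
  same_component x y -> same_component y z -> same_component x z.
Proof. by move=> xy yz w wfix; have [-> ->] := xy w wfix; exact: yz. Qed.

Lemma same_component_fixed x y : fixed x -> same_component x y -> y = x.
Proof.
move=> xfix /(_ x xfix); rewrite ltxx => -[xy yx].
by apply: le_anti; rewrite !leNgt -xy -yx.
Qed.

(** Only suprema being available, the infimum [r] of the fixed points above [x] is obtained as the
    supremum of their lower bounds. Both ends are suprema of invariant sets, hence fixed. *)
Lemma component_ends x : ~ fixed x -> exists l r,
  [/\ fixed l, fixed r & forall y, same_component x y <-> l < y < r].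
Proof.
move=> xnfix.
have [l lsup] := sup_exists [set z | fixed z /\ z <= x].
have [r rsup] := sup_exists [set w | forall z, fixed z -> x <= z -> w <= z].
have lfix : fixed l by apply: fixed_sup lsup => g z /= [zfix zx]; rewrite zfix.
have rfix : fixed r.
  by apply: fixed_sup rsup => g w /= wz z zfix xz; rewrite -(zfix g) act_le wz.
have lx : l < x.
  rewrite lt_neqAle; apply/andP; split; first by apply: contra_notN xnfix => /eqP <-.
  by apply: lsup.2 => z [].
have xr : x < r.
  rewrite lt_neqAle; apply/andP; split; first by apply: contra_notN xnfix => /eqP ->.
  by apply: rsup.1 => z.
exists l, r; split => // y; split.
  by move=> xy; have [<- _] := xy l lfix; have [_ <-] := xy r rfix; rewrite lx.
move=> /andP[ly yr] z zfix.
have [zx|xz] := leP z x.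
  have zl : z <= l by apply: lsup.1.
  by rewrite !(le_lt_trans zl)//; split=> //; apply/esym/negbTE;
    rewrite -leNgt ltW ?(le_lt_trans zl)// !ltNge ltW ?(le_lt_trans zl).
have rz : r <= z by apply: rsup.2 => w; apply => //; exact: ltW.
rewrite !ltNge (ltW xz) (ltW (lt_le_trans yr rz)) /=.
by split=> //; apply/esym; rewrite -ltNge (lt_le_trans yr).
Qed.

(** The neighbourhood is common to all of [P]; infinitely many elements, each tame by itself, may
    fail to be tame together. *)
Definition tame (P : set G) : Prop :=
  forall b x, fixed x -> side b x [set t | forall p, P p -> act p t = t].

Lemma actJ_fix q h t : act q (act h^-1 t) = act h^-1 t ->
  act (q ^ h^-1) t = t.
Proof. by move=> qt; rewrite conjgE invgK !actM qt actVK. Qed.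

(** [q ^ h^-1] is [h q h^-1], whose support is the image under [h] of that of [q]. *)
Definition shifted_commutators (P : set G) (h : G) : set G :=
  [set [~ p, q ^ h^-1] | p in P & q in P].

Lemma shifted_commutators_tame P h : tame P -> tame (shifted_commutators P h).
Proof.
move=> Pt b x xfix; apply: filterS2 (Pt b x xfix) (side_act h^-1 xfix (Pt b x xfix)).
by move=> t /= tP hP _ [p Pp [q Pq <-]]; apply: actR_fix; [exact: tP | exact/actJ_fix/hP].
Qed.

(* Pushing one end of the support of [P] in the component of [x] past the
   other end. *)
Lemma displacement P x : tame P -> exists h, forall y, same_component x y ->
  forall p, shifted_commutators P h p -> act p y = y.
Proof.
move=> Pt; have [xfix|xnfix] := pselect (fixed x).
  by exists 1 => y /(same_component_fixed xfix) -> p _.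
have [l [r [lfix rfix lr]]] := component_ends xnfix.
have /lr/andP[lx xr] : same_component x x by [].
have [a la aP] := Pt true l lfix x lx.
have [b br bP] := Pt false r rfix x xr.
rewrite /= in la aP br bP.
(* The supremum of the orbit of [a] is fixed; no fixed point lies strictly between [l] and [r], so
   it is at least [r], beyond [b]. *)
have [h bh] : exists h, b < act h a.
  have [m msup] := sup_exists [set act h a | h in setT].
  have mfix : fixed m.
    by apply: fixed_sup msup => g _ [h _ <-]; rewrite -actM; exists (g * h).
  have am : a <= m by apply: msup.1; exists 1.
  have [|_ [h _ <-] bh] := @lt_is_sup _ _ b msup; last by exists h.
  apply: lt_le_trans br _; rewrite leNgt; apply/negP => mr.
  have lm : l < m by exact: lt_le_trans am.
  have /lr/same_component_sym/(same_component_fixed mfix) xm : l < m < r by rewrite lm.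
  by apply: xnfix; rewrite xm.
exists h => y /lr/andP[ly yr] _ [p Pp [q Pq <-]].
set s := q ^ h^-1.
have s_fix t : l < t -> t < act h a -> act s t = t.
  move=> lt th; apply: actJ_fix; apply: aP => //; first by rewrite -(act_lt h) actVK lfix.
  by rewrite -(act_lt h) actVK.
move: s s_fix => s s_fix.
have p_fix t : b < t -> t < r -> act p t = t by move=> *; exact: bP.
have ends g t : l < t < r -> l < act g t < r.
  by rewrite -{2}(lfix g) -{2}(rfix g) !act_lt.
rewrite commgEl conjgE !actM.
(* In the component, [p] preserves the part up to [b] and [s] the part beyond [b], so on each part
   one entry of the commutator acts trivially. *)
have [yb|by_] := leP y b.
  have sy := s_fix y ly (le_lt_trans yb bh).
  have /andP[lpy pyr] : l < act p y < r by apply: ends; rewrite ly.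
  have pyb : act p y <= b.
    rewrite leNgt; apply/negP => bpy.
    have /(congr1 (act p^-1)) := p_fix _ bpy pyr; rewrite !actK => py.
    by move: bpy; rewrite py ltNge yb.
  rewrite sy; have /actV_fix -> := s_fix _ lpy (le_lt_trans pyb bh).
  by rewrite actK.
have /andP[lsy syr] : l < act s y < r by apply: ends; rewrite ly.
have bsy : b < act s y.
  rewrite ltNge; apply/negP => syb.
  have /(congr1 (act s^-1)) := s_fix _ lsy (le_lt_trans syb bh); rewrite !actK => sy.
  by move: syb; rewrite sy leNgt by_.
by rewrite p_fix// actK; apply/actV_fix/p_fix.
Qed.

Definition moves (P : set G) (x : X) : Prop := exists2 p, P p & act p x <> x.

(* Compactness of [X], in the form of a supremum argument: a point [x] has a
   neighbourhood [Y] meeting at most one component that [P] moves. *)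
Lemma finitely_many_components P : tame P -> exists s : seq X,
  forall y, moves P y -> exists2 x, x \in s & same_component x y.
Proof.
move=> Pt.
pose covers (s : seq X) (Y : set X) := forall y, Y y -> moves P y ->
  exists2 x, x \in s & same_component x y.
(* Near a fixed point tameness leaves nothing to cover; elsewhere the component of [x] is itself a
   neighbourhood. *)
have local x : exists s (Y : set X), [/\ covers s Y, Y x &
    forall b, side b x Y].
  have [xfix|xnfix] := pselect (fixed x).
    exists [::], [set y | forall p, P p -> act p y = y]; split.
    - by move=> y yP [p /yP].
    - by move=> p _; exact: xfix.
    - by move=> b; exact: Pt.
  have [l [r [lfix rfix lr]]] := component_ends xnfix.
  exists [:: x], [set y | l < y < r]; split.
  - by move=> y /lr xy _; exists x; rewrite ?mem_head.
  - exact/lr.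
  - move=> b w xw; have /lr/andP[lx xr] : same_component x x by [].
    case: b xw => /= _; [exists r => // t xt tr | exists l => // t tx lt].
      by rewrite (lt_trans lx).
    by rewrite lt (lt_trans tx).
have [m msup] := sup_exists [set x | exists s, covers s [set y | y < x]].
have [s [Y [sY Ym mY]]] := local m.
have [s' s'P] : exists s' : seq X, covers s' [set y | y <= m].
  have [[w wm]|m_min] := pselect (exists w, w < m).
    have [l lm lY] := mY false w wm.
    have [x [s' s'P] lx] := lt_is_sup msup lm.
    exists (s' ++ s) => y ym yP.
    have [yx|xy] := ltP y x.
      by have [z zs zy] := s'P y yx yP; exists z; rewrite // mem_cat zs.
    have [|z zs zy] := sY y _ yP; last by exists z; rewrite // mem_cat zs orbT.
    move: ym; rewrite /= le_eqVlt => /predU1P[->//|ym].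
    by apply: lY => //=; exact: lt_le_trans xy.
  exists s => y; rewrite /= le_eqVlt => /predU1P[->|ym]; first exact: sY.
  by case: m_min; exists y.
(* A point beyond [m] would let the neighbourhood of [m] extend the cover past the supremum; so [m]
   is the greatest element. *)
have [[w mw]|m_max] := pselect (exists w, m < w); last first.
  by exists s' => y; apply: s'P; rewrite /= leNgt; apply/negP => my; apply: m_max; exists y.
have [r mr rY] := mY true w mw.
suff rm : r <= m by move: mr; rewrite /= ltNge rm.
apply: msup.1; exists (s' ++ s) => y /= yr yP.
have [ym|my] := leP y m.
  by have [z zs zy] := s'P y ym yP; exists z; rewrite // mem_cat zs.
have [|z zs zy] := sY y _ yP; first exact: rY.
by exists z; rewrite // mem_cat zs orbT.
Qed.

Variables (J : groupType) (phi : {multiplicative G -> J}).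
Hypothesis phi_surj : forall y : J, exists x, phi x = y.
Hypotheses (jiJ : just_infinite J) (nvaJ : ~ virtually_abelian J).

(** Induction on a list of components containing all points moved by [P]. Shifted commutators fix
    the component of [x] pointwise, yet their images are all commutators of the image of [P]. By
    induction these vanish, and the image is abelian. *)
Lemma tame_image_trivial P : tame P -> conj_stable (phi @` P) ->
  forall p, P p -> phi p = 1.
Proof.
move=> Pt; have [s] := finitely_many_components Pt.
elim: s P Pt => [P _ none _ p Pp|x s IH P Pt xs Pc].
  suff -> : p = 1 by exact: morph1.
  by apply: act_faithful => t; apply: contrapT => pt; have [|] := none t; first by exists p.
have [h hP] := displacement x Pt.
pose P' := shifted_commutators P h.
have P'image : phi @` P' = [set [~ a, b] | a in phi @` P & b in phi @` P].
  apply/seteqP; split.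
    move=> _ [_ [p Pp [q Pq <-]] <-]; rewrite morphR morphJ.
    exists (phi p); first exact: imageP.
    by exists (phi q ^ phi h^-1) => //; apply: Pc; exact: imageP.
  move=> _ [_ [p Pp <-] [_ [q Pq <-] <-]].
  (* Conjugating by [phi h] beforehand is undone by the shift by [h^-1]. *)
  have [q' Pq' qE] : (phi @` P) (phi q ^ phi h) by apply/Pc/imageP.
  exists [~ p, q' ^ h^-1]; first by exists p => //; exists q'.
  by rewrite morphR morphJ qE morphV conjgK.
have P'1 : forall p, P' p -> phi p = 1.
  apply: IH; first exact: shifted_commutators_tame.
    move=> y [p P'p py].
    (* The action of [h] preserves components, so shifted commutators are trivial on any component
       that [P] fixes pointwise. *)
    have [z Pz yz] : exists2 z, moves P z & same_component z y.
      apply: contrapT => nz; apply: py; case: P'p => p1 Pp1 [q Pq <-].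
      have Pfix z : same_component z y -> forall q, P q -> act q z = z.
        by move=> zy q' Pq'; apply: contrapT => qz; apply: nz; exists z => //; exists q'.
      apply: actR_fix; first exact: Pfix.
      by apply/actJ_fix/Pfix => //; apply/same_component_sym; exact: same_component_act.
    have [w + wz] := xs z Pz; have wy := same_component_trans wz yz.
    rewrite inE => /predU1P[wx|ws]; last by exists w.
    by case: py; apply: hP => //; rewrite -wx.
  by rewrite P'image; exact: conj_stable_commutators.
move=> p Pp; apply: (abelian_normal_trivial jiJ nvaJ Pc); last exact: imageP.
move=> a b Pa Pb; apply/commgP/eqP.
have [q P'q <-] : (phi @` P') [~ a, b] by rewrite P'image; exists a => //; exists b.
exact: P'1.
Qed.

(** Finitely many neighbourhoods intersect in a neighbourhood, and the stabilizer of a point is a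
    subgroup. *)
Lemma tame_generated (s : seq G) :
  (forall g, g \in s -> tame [set g]) -> tame [set` generated (mem [set` s])].
Proof.
move=> st b x xfix.
have : side b x [set t | forall g, g \in s -> act g t = t].
  elim: s st => [_|g s IH st]; first by apply: filterE => t g.
  have gP := st g (mem_head _ _) b x xfix.
  have sP : side b x [set t | forall h, h \in s -> act h t = t].
    by apply: IH => h hs; apply: st; rewrite inE hs orbT.
  by apply: filterS2 gP sP => t /= gt sT h; rewrite inE => /predU1P[->|/sT//]; exact: gt.
move=> xs; apply: (filterS (F := side b x)) (xs) => t /= st'.
move=> p /=; move: p; apply: (@generated_ind _ _ [set g | act g t = t]) => /=.
- exact: act1.
- by move=> g h gt ht; rewrite actM ht.
- by move=> g; exact: actV_fix.
- by move=> g /set_mem; exact: st'.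
Qed.

Definition double_commutators (H : groupType) : set H :=
  [set [~ x, y] | x in [set [~ a, b] | a in setT & b in setT]
                & y in [set [~ a, b] | a in setT & b in setT]].

Lemma double_commutators_conj (H : groupType) : conj_stable (@double_commutators H).
Proof. by apply: conj_stable_commutators; apply: conj_stable_commutators. Qed.

(** Otherwise the commutators of [J] commute with each other, so they are trivial by
    [abelian_normal_trivial], and [J] is abelian. *)
Lemma nonabelian_double_commutators :
  ~ (forall x, double_commutators (H := J) x -> x = 1).
Proof.
move=> triv; apply: nvaJ.
have comm1 (x y : J) : [~ x, y] = 1.
  pose C : set J := [set [~ a, b] | a in setT & b in setT].
  have Cc : conj_stable C by exact: conj_stable_commutators.
  apply: (abelian_normal_trivial jiJ nvaJ Cc); last by exists x => //; exists y.
  by move=> a b Ca Cb; apply/commgP/eqP/triv; exists a => //; exists b.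
have [K KT] := @groupClosed_of J setT I (fun _ _ _ _ => I) (fun _ _ => I).
exists K; last by move=> x y _ _; exact/commgP/eqP.
by exists [:: 1] => x; exists 1; rewrite ?mem_head// KT; exact/mem_set.
Qed.

Hypothesis fgG : finitely_generated G.

(** The double commutators need not be tame together. Schreier's lemma in [J] replaces them by
    finitely many elements of the subgroup they generate, whose images still generate [M]. *)
Lemma no_tame_double_commutators :
  (forall w, double_commutators (H := G) w -> tame [set w]) -> False.
Proof.
move=> Wt; pose W := double_commutators (H := G).
have Wc : conj_stable W by exact: double_commutators_conj.
pose M : groupClosed J := generated (mem (phi @` W)).
have Mn : normal_subgroup M by exact/generated_normal/conj_stable_image.
have W1 : (phi @` W) `<=` [set 1].
  apply: contrapT => /existsNP[y /not_implyP[Wy y1]].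
  have Mfin : finite_index M.
    by apply: jiJ => //; exists y; [exact/mem_generated/mem_set | exact/eqP].
  have [r rM Mr] := schreier (finitely_generated_image phi_surj fgG) Mfin.
  have [s sW sr] : exists2 s : seq G,
      (forall g, g \in s -> g \in generated (mem W)) & map phi s = r.
    elim: r rM {Mr} => [_|a r IH arM]; first by exists [::].
    have [|s sW <-] := IH; first by move=> b br; apply: arM; rewrite inE br orbT.
    have : [set` generated (mem (phi @` W))] a by apply: arM; rewrite mem_head.
    rewrite -generated_image => -[g gW <-].
    by exists (g :: s) => // h; rewrite inE => /predU1P[->//|/sW].
  have genW_tame g : g \in generated (mem W) -> tame [set g].
    move: g; apply: (@generated_ind _ _ [set g | tame [set g]]) => /=.
    - by move=> b x _; apply: filterE => t _ ->.
    - move=> g h gt ht b x xfix; apply: filterS2 (gt b x xfix) (ht b x xfix).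
      by move=> t /= gP hP _ ->; rewrite actM hP// gP.
    - move=> g gt b x xfix; apply: (filterS (F := side b x)) (gt b x xfix) => t /= gP _ ->.
      exact/actV_fix/gP.
    - by move=> w /set_mem; exact: Wt.
  pose P := [set` generated (mem [set` s])].
  have PM : phi @` P = [set` M].
    rewrite /P generated_image; apply/seteqP; split=> x /=.
      apply: generated_sub => z /set_mem[g gs <-]; apply: rM.
      by rewrite -sr; exact: map_f.
    move=> /Mr; apply: generated_sub => z.
    change (z \in r -> z \in generated (mem [set phi x | x in [set` s]])).
    by rewrite -sr => /mapP[g gs ->]; apply/mem_generated/mem_set/imageP.
  have Pt : tame P by apply: tame_generated => g gs; exact/genW_tame/sW.
  have Pc : conj_stable (phi @` P) by rewrite PM => x z; exact: Mn.
  apply: y1; have [p Pp <-] : (phi @` P) y by rewrite PM; exact/mem_generated/mem_set.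
  exact: tame_image_trivial Pc p Pp.
apply: nonabelian_double_commutators => _ [_ [x1 _ [x2 _ <-]] [_ [x3 _ [x4 _ <-]] <-]].
have [[g1 <-] [g2 <-]] := (phi_surj x1, phi_surj x2).
have [[g3 <-] [g4 <-]] := (phi_surj x3, phi_surj x4).
rewrite -!morphR; apply: W1; apply: imageP.
by exists [~ g1, g2]; [exists g1 => //; exists g2 | exists [~ g3, g4] => //; exists g3 => //; exists g4].
Qed.

End Dynamics.

(** * The criterion for complete orders *)

Section Criterion.
Local Open Scope group_scope.
Local Open Scope classical_set_scope.
Local Open Scope order_scope.

Theorem affine_germs_elementarily_just_infinite (d : Order.disp_t)
    (X : orderType d) (G : groupType) (act : G -> X -> X) (K : fieldType) :
  (forall A : set X, exists m, is_sup A m) ->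
  (forall t, act 1 t = t) -> (forall g h t, act (g * h) t = act g (act h t)) ->
  (forall g, {homo act g : x y / x < y}) ->
  (forall g, (forall t, act g t = t) -> g = 1) ->
  (forall b x, fixed act x -> exists (u : X -> K) (B : set X),
    [/\ side b x B, {in B &, injective u} &
      forall g, exists m c, affine_germ act (side b x) u g m c]) ->
  finitely_generated G -> elementarily_just_infinite G.
Proof.
move=> sup_exists act1 actM act_homo act_faithful germs fgG J phi phi_surj jiJ.
apply: contrapT => nvaJ.
apply: (no_tame_double_commutators sup_exists act1 actM act_homo act_faithful
  phi_surj jiJ nvaJ fgG).
move=> _ [_ [g1 _ [g2 _ <-]] [_ [g3 _ [g4 _ <-]] <-]] b x xfix.
have [u [B [xB uB uA]]] := germs b x xfix.
have F_act g A : side b x A -> side b x [set t | A (act g t)].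
  exact: side_act.
apply: (filterS (F := side b x)) (double_commutator_germ act1 actM
  (side_filter b x) F_act xB uB uA g1 g2 g3 g4).
  exact: side_filter.
by move=> t /= wt _ ->.
Qed.

End Criterion.

(** * The criterion for the real line *)

Section RealLine.
Local Open Scope classical_set_scope.
Local Open Scope ring_scope.
Variable R : realType.

Lemma ereal_is_sup (A : set (\bar R)) : exists m, is_sup A m.
Proof.
exists (ereal_sup A); split => [x|y yA]; first exact: ereal_sup_ubound.
exact: ge_ereal_sup.
Qed.

(** The infinities are added as fixed points, which makes the line complete as an order. *)
Definition ereal_map (f : R -> R) (x : \bar R) : \bar R :=
  if x is r%:E then (f r)%:E else x.

Lemma ereal_map_homo (f : R -> R) : {homo f : x y / x < y} ->
  {homo ereal_map f : x y / (x < y)%E}.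
Proof. by move=> f_homo [x| |] [y| |] //=; rewrite ?lte_fin ?ltry ?ltNyr//; exact: f_homo. Qed.

Lemma side_EFin b (r : R) (A : set R) :
  side b r A -> side b r%:E [set x%:E | x in A].
Proof.
move=> rA w rw.
have [r' rr' r'A] : exists2 r', toward b r r' &
    forall t, toward b r t -> toward b t r' -> A t.
  by apply: (rA (if b then r + 1 else r - 1)); case: b {rA rw} => /=; lra.
exists r'%:E; first by case: b {rA rw r'A} rr' => /=; rewrite lte_fin.
move=> [t| |]; case: b {rA rw rr'} r'A => /= r'A; rewrite ?lte_fin// => *;
  by exists t => //; exact: r'A.
Qed.

Lemma side_infty (b : bool) (M : R) (A : set R) :
  (forall t, M < (if b then - t else t) -> A t) ->
  side b (if b then -oo else +oo)%E [set x%:E | x in A].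
Proof.
move=> MA w _; exists (if b then - M else M)%:E.
  by case: b {MA}; rewrite /= ?ltry ?ltNyr.
move=> [t| |]; case: b MA => /= MA //; rewrite lte_fin => _ tM;
  by exists t => //; apply: MA; rewrite // ltrNr.
Qed.

Local Open Scope group_scope.

Theorem affine_germs_elementarily_just_infinite_line (G : groupType)
    (act : G -> R -> R) :
  (forall t, act 1 t = t) -> (forall g h t, act (g * h) t = act g (act h t)) ->
  (forall g, {homo act g : x y / (x < y)%R}) ->
  (forall g, (forall t, act g t = t) -> g = 1) ->
  (forall b x, fixed act x -> exists2 u : R -> R, injective u &
    forall g, exists m c, affine_germ act (side b x) u g m c) ->
  (forall (b : bool) g, exists k M, forall t,
    (M < (if b then - t else t))%R -> act g t = (t + k)%R) ->
  finitely_generated G -> elementarily_just_infinite G.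
Proof.
move=> act1 actM act_homo act_faithful germs ends.
pose Act g := ereal_map (act g).
apply: (affine_germs_elementarily_just_infinite (act := Act) (K := R)).
- exact: ereal_is_sup.
- by move=> [t| |] //; rewrite /Act /= act1.
- by move=> g h [t| |] //; rewrite /Act /= actM.
- by move=> g; exact: ereal_map_homo.
- by move=> g gt; apply: act_faithful => t; have [] := gt t%:E.
pose real := [set x%:E | x in [set: R]].
have fine_inj (v : R -> R) : injective v -> {in real &, injective (v \o fine)}.
  by move=> v_inj _ _ /set_mem[s _ <-] /set_mem[t _ <-] /= /v_inj ->.
move=> b x xfix.
(* On the outer side of an infinity there are no points: every set is in the filter, and an empty
   [B] will do. *)
have [[w xw]|nx] := pselect (exists w, toward b x w); last first.
  exists fine, set0; split.
  - by move=> w xw; case: nx; exists w.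
  - by move=> s t /set_mem.
  - move=> g; exists 1%R, 0%R; split; first exact: oner_neq0.
    by move=> w xw; case: nx; exists w.
have ends_germs : exists (u : \bar R -> R) (B : set (\bar R)),
    [/\ side b (if b then -oo else +oo)%E B, {in B &, injective u} &
      forall g, exists m c, affine_germ Act (side b (if b then -oo else +oo)%E) u g m c].
  exists fine, real; split.
  - by apply: (@side_infty _ 0%R).
  - by apply: (fine_inj id).
  - move=> g; have [k [M gM]] := ends b g; exists 1%R, k; split; first exact: oner_neq0.
    apply: (@filterS _ _ (side_filter _ _)) (side_infty gM) => _ [t /= gt <-] /=.
    by rewrite gt mul1r.
case: x xfix xw => [x| |] xfix xw; last 2 first.
- by case: b ends_germs xw => // _; rewrite /= ltNge leey.
- by case: b ends_germs xw => // _; rewrite /= ltNge leNye.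
have [|u u_inj uP] := germs b x; first by move=> g; have [] := xfix g.
exists (u \o fine), real; split.
- exact/side_EFin/(@filterT _ _ (side_filter _ _)).
- exact: fine_inj.
- move=> g; have [m [c [m0 gA]]] := uP g; exists m, c; split => //.
  by apply: (@filterS _ _ (side_filter _ _)) (side_EFin gA) => _ [t /= gt <-].
Qed.

End RealLine.

(** * Thompson's group F *)

Section Thompson.
Local Open Scope classical_set_scope.
Local Open Scope ring_scope.
Variable R : realType.
Local Notation I := (unit_segment R).

Definition extend (f : I -> I) (r : R) : R :=
  if pselect (exists x : I, coordinate x = r) is left ex
  then coordinate (f (projT1 (cid ex))) else r.

Lemma extend_in f (x : I) : extend f (coordinate x) = coordinate (f x).
Proof.
rewrite /extend; case: pselect => [ex|[]]; last by exists x.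
by case: cid => y /= /coord_inj ->.
Qed.

Lemma extend_out f r : ~~ (0 <= r <= 1) -> extend f r = r.
Proof.
move=> /negP rn; rewrite /extend; case: pselect => // ex; case: rn.
by have [x <-] := ex; exact: coord_itv.
Qed.

Variant unit_spec (r : R) : Prop :=
| UnitIn (x : I) of coordinate x = r
| UnitOut of ~~ (0 <= r <= 1).

Lemma unitP r : unit_spec r.
Proof.
have [/coord_surj[x xr]|rn] := boolP (0 <= r <= 1); first exact: UnitIn xr.
exact: UnitOut.
Qed.

Lemma extend_homo f : orientation_preserving f -> {homo extend f : x y / x < y}.
Proof.
move=> f_homo x y; case: (unitP x) => [x' <-|xn]; case: (unitP y) => [y' <-|yn].
- by rewrite !extend_in; exact: f_homo.
- rewrite extend_in (extend_out _ yn) => xy; have := coord_itv (f x'); have := coord_itv x'.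
  by move: yn xy; rewrite negb_and -!ltNge => /orP[] + + /andP[? ?] /andP[? ?]; lra.
- rewrite extend_in (extend_out _ xn) => xy; have := coord_itv (f y'); have := coord_itv y'.
  by move: xn xy; rewrite negb_and -!ltNge => /orP[] + + /andP[? ?] /andP[? ?]; lra.
- by rewrite !extend_out.
Qed.

Lemma affine_slope_neq0 (f : I -> I) m c u v : orientation_preserving f ->
  coordinate u < coordinate v -> affine_with f m c u v -> m != 0.
Proof.
move=> f_homo uv fA; apply/eqP => m0; have := f_homo u v uv.
by rewrite !fA ?lexx ?(ltW uv)// m0 !mul0r ltxx.
Qed.

(** Next to [r] the map is either the identity, outside the unit interval, or affine on a segment
    with no listed point inside. *)
Lemma extend_germ f b (r : R) : PLplus f -> exists m c : R,
  m != 0 /\ side b r [set t | extend f t = m * t + c].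
Proof.
move=> [f_homo [s sA]].
have trivial_germ w : toward b r w ->
    (forall t, toward b r t -> toward b t w -> ~~ (0 <= t <= 1)) ->
    exists m c : R, m != 0 /\ side b r [set t | extend f t = m * t + c].
  move=> rw wP; exists 1, 0; split; first exact: oner_neq0.
  by move=> _ _; exists w => // t rt tw /=; rewrite mul1r addr0 extend_out ?wP.
have affine_on_germ u v : coordinate u < coordinate v -> missing s u v ->
    r = coordinate (if b then u else v) ->
    exists m c : R, m != 0 /\ side b r [set t | extend f t = m * t + c].
  move=> uv suv rE; have [m [c fA]] := sA u v uv suv.
  exists m, c; split; first exact: affine_slope_neq0 uv fA.
  move=> _ _; exists (coordinate (if b then v else u)); first by rewrite rE; case: (b).
  move=> t rt tr.
  have tuv : coordinate u < t < coordinate v.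
    by move: rt tr; rewrite rE; case: (b) => /= -> ->.
  have [y yt] : exists y : I, coordinate y = t.
    apply: coord_surj; have /andP[? ?] := coord_itv u; have /andP[? ?] := coord_itv v.
    by move: tuv => /andP[? ?]; apply/andP; split; lra.
  by rewrite /= -yt extend_in fA// yt; move: tuv => /andP[/ltW -> /ltW ->].
case: b trivial_germ affine_on_germ => triv aff.
- have [r0|r0] := ltP r 0.
    by apply: (triv 0) => //= t _ t0; rewrite negb_and -!ltNge t0.
  have [r1|r1] := leP 1 r.
    apply: (triv (r + 1)) => [|t rt _] /=; first by lra.
    by rewrite negb_and -!ltNge (le_lt_trans r1 rt) orbT.
  have [x xr] : exists x : I, coordinate x = r by apply: coord_surj; rewrite r0 ltW.
  have [|v xv sv] := @gap_right R s x; first by rewrite xr.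
  exact: aff xv sv _.
- have [r1|r1] := ltP 1 r.
    by apply: (triv 1) => //= t _ t1; rewrite negb_and -!ltNge t1 orbT.
  have [r0|r0] := leP r 0.
    apply: (triv (r - 1)) => [|t rt _] /=; first by lra.
    by rewrite negb_and -!ltNge (lt_le_trans rt r0).
  have [x xr] : exists x : I, coordinate x = r by apply: coord_surj; rewrite r1 ltW.
  have [|u ux su] := @gap_left R s x; first by rewrite xr.
  exact: aff ux su _.
Qed.

Lemma thompson_F_LEJI : LEJI (thompson_F R).
Proof.
move=> H fgH; pose elt (g : subgroup_type H) : homeo I := val (val g).
have eltF g : in_thompson_F (elt g) by apply/asboolP; exact: (valP (val g)).
have elt_homo g : orientation_preserving (elt g) by case: (eltF g) => -[].
apply: (@affine_germs_elementarily_just_infinite_line R _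
  (fun g => extend (elt g)) _ _ _ _ _ _ fgH).
- by move=> t; case: (unitP t) => [x <-|tn]; rewrite ?extend_in ?extend_out.
- move=> g h t; case: (unitP t) => [x <-|tn]; rewrite ?extend_in ?extend_out//.
- by move=> g; exact: extend_homo.
- move=> g g1; apply/val_inj/val_inj/homeoP => x; apply: coord_inj.
  by rewrite -extend_in g1.
- move=> b x _; exists id => // g; apply: extend_germ; by case: (eltF g).
(* Farther than 1 from the origin the extension is the identity, a translation by 0. *)
- move=> b g; exists 0, 1 => t t1; rewrite addr0 extend_out// negb_and -!ltNge.
  by case: b t1 => t1; apply/orP; [left | right]; lra.
Qed.

End Thompson.

(** * Piecewise Moebius maps and the Lodha-Moore group *)

Section LodhaMooreGerms.
Local Open Scope classical_set_scope.
Local Open Scope ring_scope.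
Variable R : realType.
Implicit Types f g h : homeo R.

Definition mobius_at (f : R -> R) (a b c d t : R) : Prop :=
  c * t + d != 0 /\ f t * (c * t + d) = a * t + b.

(** The formula is also required at [x], so that [f x = x] becomes a relation between the
    coefficients. *)
Definition mobius_germ (s : bool) (x : R) (f : R -> R) : Prop :=
  exists a b c d, [/\ a * d - b * c != 0, mobius_at f a b c d x &
    side s x [set t | mobius_at f a b c d t]].

(* [s] is as in [side]: [true] is the right side of -oo, [false] the left side
   of +oo. *)
Definition translation_near_infinity (f : R -> R) : Prop := forall s : bool,
  exists k M, forall t, M < (if s then - t else t) -> f t = t + k.

Definition locally_mobius (f : R -> R) : Prop :=
  [/\ {homo f : x y / x < y}, forall s x, mobius_germ s x f &
    translation_near_infinity f].

Lemma side_preimage f s x A : {homo f : y z / y < z} ->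
  side s (f x) A -> side s x [set t | A (f t)].
Proof.
move=> f_homo xA w xw.
have f'_homo := increasing_inv f_homo (homeo_invK f).
have [r xr rA] : exists2 r, toward s (f x) r &
    forall t, toward s (f x) t -> toward s t r -> A t.
  by apply: (xA (f w)); case: (s) xw => /=; exact: f_homo.
exists (homeo_inv f r).
  by case: (s) xr => /= /f'_homo; rewrite homeo_funK.
move=> t xt tr; apply: rA; first by case: (s) xt => /=; exact: f_homo.
by rewrite -[r](homeo_invK f); case: (s) tr => /=; exact: f_homo.
Qed.

Lemma locally_mobius1 : locally_mobius (1%g : homeo R).
Proof.
split=> // [s x|s]; last by exists 0, 0 => t _; rewrite addr0.
have id_mobius t : mobius_at (1%g : homeo R) 1 0 0 1 t.
  by split; [apply/eqP; lra | rewrite /=; ring].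
exists 1, 0, 0, 1; split; [by apply/eqP; lra | exact: id_mobius |].
by apply: (@filterE _ _ (side_filter _ _)).
Qed.

Lemma locally_mobiusM f g : locally_mobius f -> locally_mobius g ->
  locally_mobius (f * g)%g.
Proof.
move=> [f_homo fM fT] [g_homo gM gT]; split.
- by move=> x y /g_homo /f_homo.
- move=> s x; have [a [b [c [d [D gx xg]]]]] := gM s x.
  have [a' [b' [c' [d' [D' fx xf]]]]] := fM s (g x).
  (* The coefficients are those of the matrix product, and the denominators multiply. *)
  have comp t : mobius_at g a b c d t -> mobius_at f a' b' c' d' (g t) ->
      mobius_at (f * g)%g (a' * a + b' * c) (a' * b + b' * d)
        (c' * a + d' * c) (c' * b + d' * d) t.
    move=> [gt0 gt] [ft0 ft].
    have e : (c' * a + d' * c) * t + (c' * b + d' * d) =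
        (c' * g t + d') * (c * t + d).
      by rewrite [RHS]mulrDl -[c' * g t * _]mulrA gt; ring.
    split; first by rewrite e mulf_neq0.
    change ((f * g)%g t) with (f (g t)).
    by rewrite e mulrA ft [LHS]mulrDl -[a' * g t * _]mulrA gt; ring.
  exists (a' * a + b' * c), (a' * b + b' * d), (c' * a + d' * c), (c' * b + d' * d).
  split; [|exact: comp|].
    by rewrite (_ : _ - _ = (a' * d' - b' * c') * (a * d - b * c)); [exact: mulf_neq0 | ring].
  apply: (@filterS2 _ _ (side_filter _ _)) xg (side_preimage g_homo xf) => t; exact: comp.
- move=> s; have [k [M gk]] := gT s; have [k' [M' fk]] := fT s.
  (* The inner map shifts [t] by [k], so the outer threshold is raised by the absolute value of
     [k]. *)
  exists (k + k'), (Num.max M (M' + `|k|)) => t; rewrite gt_max => /andP[Mt M't].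
  change ((f * g)%g t) with (f (g t)); rewrite (gk _ Mt) fk ?addrA//.
  have := ler_norm k; have := ler_norm (- k); rewrite normrN.
  by case: (s) M't => M't; lra.
Qed.

Lemma locally_mobiusV f : locally_mobius f -> locally_mobius (f^-1)%g.
Proof.
move=> [f_homo fM fT].
have f'_homo : {homo (f^-1)%g : x y / x < y}.
  exact: (increasing_inv f_homo (homeo_invK f)).
split=> //.
- move=> s x; have [a [b [c [d [D fx xf]]]]] := fM s ((f^-1)%g x).
  (* These coefficients form the adjugate matrix; a zero of its denominator would make the
     determinant vanish. *)
  have inv t : mobius_at f a b c d ((f^-1)%g t) ->
      mobius_at (f^-1)%g d (- b) (- c) a t.
    rewrite /mobius_at; have -> : f ((f^-1)%g t) = t by exact: homeo_invK.
    set t' := (f^-1)%g t => -[t'0 ft']; split.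
      apply: contra_neq D => e.
      have : (- c * t + a) * (c * t' + d) = a * d - b * c.
        by rewrite mulrDl -mulrA ft'; ring.
      by rewrite e mul0r.
    by have := ft'; lra.
  exists d, (- b), (- c), a; split; [|exact: inv|].
    by rewrite (_ : _ - _ = a * d - b * c)//; ring.
  apply: (@filterS _ _ (side_filter _ _)) (side_preimage f'_homo xf) => t; exact: inv.
- move=> s; have [k [M fk]] := fT s.
  exists (- k), (M + `|k|) => t Mt.
  have e : f (t - k) = t.
    rewrite fk ?subrK//; have := ler_norm k; have := ler_norm (- k); rewrite normrN.
    by case: (s) Mt => Mt; lra.
  by rewrite -[in LHS]e; exact: homeo_funK.
Qed.

Lemma mobius_germ_itv (f : R -> R) (s : bool) x y a b c d :
  a * d - b * c != 0 -> toward s x y ->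
  (forall t, (if s then x <= t <= y else y <= t <= x) -> mobius_at f a b c d t) ->
  mobius_germ s x f.
Proof.
move=> D xy xyf; exists a, b, c, d; split => //.
  by apply: xyf; case: (s) xy => /= /ltW ->; rewrite lexx.
move=> w _; exists y => // t xt ty; apply: xyf.
by case: (s) xt ty => /= /ltW -> /ltW ->.
Qed.

Lemma locally_mobius_a : locally_mobius (@lm_a R).
Proof.
split; first exact: lm_a_incr.
  move=> s x; apply: (@mobius_germ_itv _ _ _ (if s then x + 1 else x - 1) 1 1 0 1).
  - by apply/eqP; lra.
  - by case: s => /=; lra.
  - by move=> t _; rewrite /mobius_at mul0r add0r mulr1 mul1r oner_neq0.
by move=> s; exists 1, 0.
Qed.

Lemma locally_mobius_b : locally_mobius (@lm_b R).
Proof.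
(* Each piece is treated on its closed interval, so that a breakpoint satisfies the formulas on both
   of its sides. *)
have b1 t : t <= 0 -> mobius_at (@lm_b R) 1 0 0 1 t.
  rewrite /mobius_at => t0; split; first by apply/eqP; lra.
  by case: (lm_bP t) => *; nra.
have b2 t : 0 <= t <= 1 / 2 -> mobius_at (@lm_b R) 1 0 (- 1) 1 t.
  rewrite /mobius_at => /andP[t0 t1]; split; first by apply/eqP; lra.
  by case: (lm_bP t) => *; nra.
have b3 t : 1 / 2 <= t <= 1 -> mobius_at (@lm_b R) 3 (- 1) 1 0 t.
  rewrite /mobius_at => /andP[t0 t1]; split; first by apply/eqP; lra.
  by case: (lm_bP t) => *; nra.
have b4 t : 1 <= t -> mobius_at (@lm_b R) 1 1 0 1 t.
  rewrite /mobius_at => t1; split; first by apply/eqP; lra.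
  by case: (lm_bP t) => *; nra.
split; first exact: lm_b_incr.
- case=> x.
  + have [x0|x0] := ltP x 0.
      apply: (@mobius_germ_itv _ true x 0 1 0 0 1); [by apply/eqP; lra | by [] |].
      by move=> t /andP[_ /b1].
    have [x1|x1] := ltP x (1 / 2).
      apply: (@mobius_germ_itv _ true x (1 / 2) 1 0 (- 1) 1); [by apply/eqP; lra | by [] |].
      by move=> t /andP[xt t1]; apply: b2; rewrite t1 (le_trans x0).
    have [x2|x2] := ltP x 1.
      apply: (@mobius_germ_itv _ true x 1 3 (- 1) 1 0); [by apply/eqP; lra | by [] |].
      by move=> t /andP[xt t1]; apply: b3; rewrite t1 (le_trans x1).
    apply: (@mobius_germ_itv _ true x (x + 1) 1 1 0 1) => /=; [by apply/eqP; lra | lra |].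
    by move=> t /andP[xt _]; apply/b4/(le_trans x2).
  + have [x2|x2] := ltP 1 x.
      apply: (@mobius_germ_itv _ false x 1 1 1 0 1); [by apply/eqP; lra | by [] |].
      by move=> t /andP[/b4].
    have [x1|x1] := ltP (1 / 2) x.
      apply: (@mobius_germ_itv _ false x (1 / 2) 3 (- 1) 1 0); [by apply/eqP; lra | by [] |].
      by move=> t /andP[t1 tx]; apply: b3; rewrite t1 (le_trans tx).
    have [x0|x0] := ltP 0 x.
      apply: (@mobius_germ_itv _ false x 0 1 0 (- 1) 1); [by apply/eqP; lra | by [] |].
      by move=> t /andP[t0 tx]; apply: b2; rewrite t0 (le_trans tx).
    apply: (@mobius_germ_itv _ false x (x - 1) 1 0 0 1) => /=; [by apply/eqP; lra | lra |].
    by move=> t /andP[_ tx]; apply/b1/(le_trans tx).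
- case; [exists 0, 0 | exists 1, 1] => t t0.
    by rewrite addr0 /lm_b ifT// -oppr_ge0 ltW.
  by case: (lm_bP t) => *; lra.
Qed.

Lemma locally_mobius_c : locally_mobius (@lm_c R).
Proof.
have c1 t : t <= 0 -> mobius_at (@lm_c R) 1 0 0 1 t.
  rewrite /mobius_at => t0; split; first by apply/eqP; lra.
  by case: (lm_cP t) => *; nra.
have c2 t : 0 <= t <= 1 -> mobius_at (@lm_c R) 2 0 1 1 t.
  rewrite /mobius_at => /andP[t0 t1]; split; first by apply/eqP; lra.
  by case: (lm_cP t) => *; nra.
have c3 t : 1 <= t -> mobius_at (@lm_c R) 1 0 0 1 t.
  rewrite /mobius_at => t1; split; first by apply/eqP; lra.
  by case: (lm_cP t) => *; nra.
split; first exact: lm_c_incr.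
- case=> x.
  + have [x0|x0] := ltP x 0.
      apply: (@mobius_germ_itv _ true x 0 1 0 0 1); [by apply/eqP; lra | by [] |].
      by move=> t /andP[_ /c1].
    have [x1|x1] := ltP x 1.
      apply: (@mobius_germ_itv _ true x 1 2 0 1 1); [by apply/eqP; lra | by [] |].
      by move=> t /andP[xt t1]; apply: c2; rewrite t1 (le_trans x0).
    apply: (@mobius_germ_itv _ true x (x + 1) 1 0 0 1) => /=; [by apply/eqP; lra | lra |].
    by move=> t /andP[xt _]; apply/c3/(le_trans x1).
  + have [x1|x1] := ltP 1 x.
      apply: (@mobius_germ_itv _ false x 1 1 0 0 1); [by apply/eqP; lra | by [] |].
      by move=> t /andP[/c3].
    have [x0|x0] := ltP 0 x.
      apply: (@mobius_germ_itv _ false x 0 2 0 1 1); [by apply/eqP; lra | by [] |].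
      by move=> t /andP[t0 tx]; apply: c2; rewrite t0 (le_trans tx).
    apply: (@mobius_germ_itv _ false x (x - 1) 1 0 0 1) => /=; [by apply/eqP; lra | lra |].
    by move=> t /andP[_ tx]; apply/c1/(le_trans tx).
- case; [exists 0, 0 | exists 0, 1] => t t0; rewrite addr0.
    by case: (lm_cP t) => *; lra.
  by case: (lm_cP t) => *; lra.
Qed.

Lemma lodha_moore_locally_mobius (g : lodha_moore R) : locally_mobius (val g).
Proof.
have := valP g; move: (val g).
apply: (@generated_ind _ _ [set g | locally_mobius (g : homeo R)]) => /=.
- exact: locally_mobius1.
- exact: locally_mobiusM.
- exact: locally_mobiusV.
- move=> f; change (f \in [:: homeo_a R; homeo_b R; homeo_c R] -> locally_mobius f).
  rewrite !inE => /or3P[] /eqP ->.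
  + exact: locally_mobius_a.
  + exact: locally_mobius_b.
  + exact: locally_mobius_c.
Qed.

(* A Moebius map fixing [x] is affine in the coordinate [(t - x)^-1]. *)
Lemma mobius_germ_fixed (f : R -> R) s x : mobius_germ s x f -> f x = x ->
  exists m c, m != 0 /\ side s x [set t | (f t - x)^-1 = m * (t - x)^-1 + c].
Proof.
move=> [a [b [c [d [D [x0 fx] xf]]]]] fxx; rewrite fxx in fx.
(* As [f x = x], the vector [(x, 1)] is an eigenvector of the matrix for [c * x + d]; the other
   eigenvalue [a - c * x] is nonzero because the determinant is. *)
have acx : a - c * x != 0.
  apply: contra_neq D => e; have ac : a = c * x by apply/eqP; rewrite -subr_eq0 e.
  have : b = d * x by move: fx; rewrite ac; lra.
  by rewrite ac => ->; ring.
exists ((c * x + d) / (a - c * x)), (c / (a - c * x)); split.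
  by rewrite mulf_neq0 ?invr_neq0.
move=> w xw; have [r xr rf] := xf w xw; exists r => // t xt tr.
have [t0 ft] := rf t xt tr.
have tx : t - x != 0.
  by rewrite subr_eq0; case: (s) xt => /= [/gt_eqF|/lt_eqF] ->.
have e : (f t - x) * (c * t + d) = (a - c * x) * (t - x).
  by rewrite mulrBl ft; lra.
rewrite /=; have -> : f t - x = (a - c * x) * (t - x) / (c * t + d) by rewrite -e mulfK.
by field; rewrite acx tx t0.
Qed.

Lemma lodha_moore_LEJI : LEJI (lodha_moore R).
Proof.
move=> H fgH; pose elt (g : subgroup_type H) : homeo R := val (val g).
have elt_mobius (g : subgroup_type H) : locally_mobius (elt g) by exact: lodha_moore_locally_mobius.
apply: (@affine_germs_elementarily_just_infinite_line R _
  elt _ _ _ _ _ _ fgH) => //.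
- by move=> g; have [] := elt_mobius g.
- by move=> g g1; apply/val_inj/val_inj/homeoP.
(* With the convention [0^-1 = 0] this coordinate is injective on the whole line, the point [x]
   included. *)
- move=> b x xfix; exists (fun t => (t - x)^-1); first by move=> s t /invr_inj /addIr.
  move=> g; apply: mobius_germ_fixed; last exact: xfix.
  by have [] := elt_mobius g.
- by move=> b g; have [_ _] := elt_mobius g; apply.
Qed.

End LodhaMooreGerms.

Theorem mainTheorem2 (R : realType) :
  LEJI (thompson_F R) /\ LEJI (lodha_moore R).
Proof. by split; [exact: thompson_F_LEJI | exact: lodha_moore_LEJI]. Qed.
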